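(* Let $n\ge 1$. For any fixed $0<t_0<1$ and any real $s\le n$, there exists a tempered distribution $f\in L^\infty_s(\mathbb{R}^n)$ such that the natural integral representation $$e^{it_0\Delta}f(0)=\int_{\mathbb{R}^n}K_{s,t_0}(-y)\,f_s(y)\,dy,\qquad f_s=\big((1+|\cdot|^2)^{s/2}\widehat f\,\big)^\vee\in L^\infty(\mathbb{R}^n),$$ diverges absolutely, i.e. $\int_{\mathbb{R}^n}|K_{s,t_0}(-y)\,f_s(y)|\,dy=+\infty$.
   Context: Fourier transform conventions: $\widehat f(\xi)=\int_{\mathbb{R}^n}e^{-ix\cdot\xi}f(x)\,dx$ and $f^\vee(x)=(2\pi)^{-n}\int_{\mathbb{R}^n}e^{ix\cdot\xi}f(\xi)\,d\xi$, extended to tempered distributions. Bessel potential space: $L^\infty_s(\mathbb{R}^n)$ is the space of tempered distributions $f$ with $f_s:=((1+|\xi|^2)^{s/2}\widehat f)^\vee\in L^\infty(\mathbb{R}^n)$, with norm $\|f\|_{L^\infty_s}=\|f_s\|_{L^\infty}$. Schrödinger operator: formally $e^{it\Delta}f(x)=(2\pi)^{-n}\int_{\mathbb{R}^n}e^{ix\cdot\xi-it|\xi|^2}\widehat f(\xi)\,d\xi$. Since $\widehat f(\xi)=(1+|\xi|^2)^{-s/2}\widehat{f_s}(\xi)$, formally $e^{it\Delta}f=K_{s,t}*f_s$, where for $t>0$ the kernel is $$K_{s,t}(x)=\frac{1}{(2\pi)^n}\int_{\mathbb{R}^n}\frac{e^{i(x\cdot\xi-t|\xi|^2)}}{(1+|\xi|^2)^{s/2}}\,d\xi,$$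 understood as an oscillatory integral, i.e. $K_{s,t}$ is the inverse Fourier transform, in the sense of tempered distributions, of $e^{-it|\xi|^2}(1+|\xi|^2)^{-s/2}$ (for $t>0$ it is a smooth function on $\mathbb{R}^n$). *)

(* Defs.v *)
From HB Require Import structures.
From mathcomp Require Import all_boot all_order all_algebra.
From mathcomp Require Import complex.
From mathcomp Require Import all_classical all_reals all_analysis.

Set Implicit Arguments.
Unset Strict Implicit.
Unset Printing Implicit Defensive.

Import Order.TTheory GRing.Theory Num.Theory.
Import numFieldNormedType.Exports.

Local Open Scope classical_set_scope.
Local Open Scope ring_scope.

(* Row vectors carry the product sigma-algebra, i.e. the one generated by the
   coordinate maps (for reals: the Borel sigma-algebra of R^n), exactly as the
   library does for n.-tuple T. *)
Section measurable_rV.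
Context {d} {T : measurableType d}.
Variable n : nat.

Let coord (i : 'I_n) (x : 'rV[T]_n) : T := x ord0 i.

Let rV_set0 : g_sigma_preimage coord set0.
Proof. exact: sigma_algebra0. Qed.

Let rV_setC A : g_sigma_preimage coord A -> g_sigma_preimage coord (~` A).
Proof. exact: sigma_algebraC. Qed.

Let rV_bigcup (F : (set 'rV[T]_n)^nat) :
  (forall i, g_sigma_preimage coord (F i)) ->
  g_sigma_preimage coord (\bigcup_i (F i)).
Proof. exact: sigma_algebra_bigcup. Qed.

HB.instance Definition _ := @isMeasurable.Build (measure_tuple_display d)
  'rV[T]_n (g_sigma_preimage coord) rV_set0 rV_setC rV_bigcup.

End measurable_rV.


Section lebesgue_rV.
Variable R : realType.

Definition cons_rV n (p : 'rV[R]_n * measurableTypeR R) : 'rV[R]_n.+1 :=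
  row_mx (const_mx p.2 : 'rV[R]_1) p.1.

Lemma measurable_coord_rV n (i : 'I_n) :
  measurable_fun setT (fun x : 'rV[R]_n => x ord0 i : measurableTypeR R).
Proof.
move=> _ Y mY; rewrite setTI; apply: sub_sigma_algebra.
rewrite -bigcup_seq/=; exists i => /=; first by rewrite mem_index_enum.
by exists Y => //; rewrite setTI.
Qed.

Lemma measurable_fun_rV d (T : measurableType d) n (f : T -> 'rV[R]_n) :
  (forall i, measurable_fun setT (fun x => f x ord0 i : measurableTypeR R)) ->
  measurable_fun setT f.
Proof.
move=> mf _ Y; rewrite setTI => mY.
suff : @measurable _ 'rV[R]_n `<=` [set A | measurable (f @^-1` A)] by exact.
apply: smallest_sub.
  split => /=; first by rewrite preimage_set0; exact: measurable0.
  - by move=> A mA; rewrite setTD preimage_setC; exact: measurableC.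
  - by move=> F mF; rewrite preimage_bigcup; exact: bigcup_measurable.
rewrite -bigcup_seq; apply: bigcup_sub => i _ A [B mB <-] /=.
rewrite setTI -comp_preimage -[X in measurable X]setTI.
exact: (mf i).
Qed.

Lemma measurable_cons_rV n : measurable_fun setT (@cons_rV n).
Proof.
apply: measurable_fun_rV => i; case: (@split_ordP 1 n i) => j ->.
  have -> : (fun p => @cons_rV n p ord0 (lshift n j)) = snd.
    by apply/funext => p; rewrite /cons_rV (@row_mxEl _ 1 1 n) mxE.
  exact: measurable_snd.
have -> : (fun p => @cons_rV n p ord0 (rshift 1 j)) =
    (fun x : 'rV[R]_n => x ord0 j) \o fst.
  by apply/funext => p; rewrite /cons_rV (@row_mxEr _ 1 1 n).
exact: (measurableT_comp (measurable_coord_rV j) measurable_fst).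
Qed.

(* n-dimensional Lebesgue measure: the n-fold product of the one-dimensional
   one, transported to row vectors; R^0 is a point of mass 1. *)
Fixpoint lebesgue_rV n : {measure set 'rV[R]_n -> \bar R} :=
  match n with
  | 0 => dirac (0 : 'rV[R]_0)
  | m.+1 => measure_function_pushforward__canonical__measure_function_Measure
      (lebesgue_rV m \x @lebesgue_measure R)%E (@measurable_cons_rV m)
  end.

Lemma lebesgue_rVS n :
  lebesgue_rV n.+1 =
  pushforward (lebesgue_rV n \x @lebesgue_measure R)%E (@cons_rV n)
  :> (set 'rV[R]_n.+1 -> \bar R).
Proof. by []. Qed.

End lebesgue_rV.

Section fourier.
Variables (R : realType) (n : nat).

Local Notation V := 'rV[R]_n.
Local Notation C := R[i].
Local Notation mu := (@lebesgue_rV R n).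
Implicit Types (x y xi : V) (f g phi : V -> C) (T : (V -> C) -> C).

Definition dotv x y : R := \sum_(i < n) x ord0 i * y ord0 i.

Definition cmod (z : C) : R := complex.Re `|z|.

Definition cis (a : R) : C := (cos a +i* sin a)%C.

Definition cmeasurable f : Prop :=
  measurable_fun setT (fun x => complex.Re (f x)) /\
  measurable_fun setT (fun x => complex.Im (f x)).

Definition cintegrable f : Prop :=
  mu.-integrable setT (fun x => (complex.Re (f x))%:E) /\
  mu.-integrable setT (fun x => (complex.Im (f x))%:E).

Definition cint f : C :=
  ((\int[mu]_x complex.Re (f x))%R +i* (\int[mu]_x complex.Im (f x))%R)%C.

Definition fourier f xi : C := cint (fun x => cis (- dotv x xi) * f x).

Definition fourier_inv f x : C :=
  (((2 * pi) ^+ n)^-1)%:C%C * cint (fun xi => cis (dotv x xi) * f xi).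

(* Complex-valued functions are differentiated componentwise. *)
Definition cderivable f x (i : 'I_n) : Prop :=
  derivable (fun z => complex.Re (f z)) x (delta_mx ord0 i) /\
  derivable (fun z => complex.Im (f z)) x (delta_mx ord0 i).

Definition cpartial (i : 'I_n) f : V -> C := fun x =>
  ('D_(delta_mx ord0 i) (fun z => complex.Re (f z)) x +i*
   'D_(delta_mx ord0 i) (fun z => complex.Im (f z)) x)%C.

(* A list of indices [:: i1; ...; ik] stands for the differential operator
   D_i1 ... D_ik. *)
Definition cpartials (a : seq 'I_n) f : V -> C := foldr cpartial f a.

Definition schwartz_bound N phi : set R :=
  [set r | exists (a : seq 'I_n) (x : V), (size a <= N)%N /\
     r = (1 + dotv x x) ^+ N * cmod (cpartials a phi x)].

(* Smoothness: all iterated partial derivatives exist; being bounded, they are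
   then automatically continuous. *)
Definition schwartz phi : Prop :=
  (forall a x i, cderivable (cpartials a phi) x i) /\
  (forall N, has_ubound (schwartz_bound N phi)).

Definition schwartz_norm N phi : R := sup (schwartz_bound N phi).

(* A distribution is a functional on all functions V -> C, of which only the
   values on Schwartz functions matter: every condition below, and every
   operation used to build one distribution from another, evaluates it on
   Schwartz functions only. *)
Definition tempered T : Prop :=
  [/\ forall phi psi, schwartz phi -> schwartz psi ->
        T (fun x => phi x + psi x) = T phi + T psi,
      forall c phi, schwartz phi -> T (fun x => c * phi x) = c * T phi
    & exists (N : nat) (M : R), forall phi, schwartz phi ->
        cmod (T phi) <= M * schwartz_norm N phi].

Definition regular_dist g : (V -> C) -> C := fun phi =>
  cint (fun x => g x * phi x).

Definition dist_fourier T : (V -> C) -> C := fun phi => T (fourier phi).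

Definition dist_fourier_inv T : (V -> C) -> C := fun phi => T (fourier_inv phi).

Definition dist_mul g T : (V -> C) -> C := fun phi => T (fun x => g x * phi x).

(* The distribution T is (integration against) the function g. *)
Definition represents g T : Prop :=
  cmeasurable g /\
  forall phi, schwartz phi ->
    cintegrable (fun x => g x * phi x) /\ T phi = regular_dist g phi.

Definition Linfty g : Prop :=
  cmeasurable g /\ ('N[mu]_+oo[(fun x => (cmod (g x))%:E)] < +oo)%E.

(* (1 + |xi|^2)^(s/2) *)
Definition bracket (s : R) xi : C := ((1 + dotv xi xi) `^ (s / 2))%:C%C.

Definition bessel (s : R) T : (V -> C) -> C :=
  dist_fourier_inv (dist_mul (bracket s) (dist_fourier T)).

(* fs is the bounded function f_s attached to f; it is unique up to equality
   almost everywhere. *)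
Definition bessel_density (s : R) T fs : Prop :=
  represents fs (bessel s T) /\ Linfty fs.

Definition Linfty_s (s : R) T : Prop :=
  tempered T /\ exists fs, bessel_density s T fs.

Definition schrodinger_symbol (s t : R) xi : C :=
  cis (- (t * dotv xi xi)) * bracket (- s) xi.

(* K is the function K_{s,t}. No regularity beyond measurability is required:
   this condition determines K up to equality almost everywhere, and for t > 0
   the smooth kernel is one such K. *)
Definition schrodinger_kernel (s t : R) K : Prop :=
  represents K (dist_fourier_inv (regular_dist (schrodinger_symbol s t))).

End fourier.

(* Main.v *)
(* Take f_s constant and nonzero, so that f is a constant function; divergence
   then means that K is not integrable. If it were, then |int K phi| <= 2 |K|_1
   for phi(x) = exp(-w |x|^2) with w = 1/(4(eps - i t0)), because |phi| <= 1.
   The inverse Fourier transform of phi is a multiple of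
   exp(-(eps - i t0)|xi|^2), which cancels the phase of the symbol, so the left
   side is C_w int (1+|xi|^2)^(-s/2) exp(-eps |xi|^2) dxi. As eps -> 0 the
   modulus of C_w stays bounded below, while the integral tends to infinity
   since (1+|xi|^2)^(-s/2) has an integral bounded below on each dyadic shell
   when s <= n. The modulus of int exp(-w |x|^2) dx comes out of the
   multiplication formula and Fourier inversion at 0, up to a factor that does
   not depend on w, so gaussian integrals need not be evaluated. *)

Require Import Defs.
From HB Require Import structures.
From mathcomp Require Import all_boot all_order all_algebra.
From mathcomp Require Import complex.
From mathcomp Require Import all_classical all_reals all_analysis.
From mathcomp Require Import measurable_realfun.
From mathcomp Require Import ring lra.
Set Implicit Arguments.
Unset Strict Implicit.
Unset Printing Implicit Defensive.
Import Order.TTheory GRing.Theory Num.Theory.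
Import numFieldNormedType.Exports.
Local Open Scope classical_set_scope.
Local Open Scope ring_scope.

(** * Lebesgue measure on row vectors *)

Section lebesgue_rV_theory.
Context {R : realType}.
Local Notation leb := (@lebesgue_measure R).
Local Open Scope ereal_scope.

(** The constant 1 cannot serve as a test function, since [K] is known only through its pairing with
    Schwartz functions; gaussians of complex parameter are Schwartz, have modulus at most 1 and an
    explicit transform. Write [C(w)] for the integral of [exp(- w |x|^2)] and [w' = 1 / (4 w)]. Two
    relations determine [|C(w)|]: inversion at the origin gives [C(w) C(w') = gauss_const], and the
    multiplication formula for the parameters [w] and [conj w'] gives [|C(w)| = |C(w')| k^-n] with
    [k = 2 |w|]. Here [gauss_const] is a product of two integrals of positive gaussians, hence
    nonzero. On the side of [f], [bessel s T phi] evaluates [T] at [fourier g] with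
    [g = bracket s * fourier_inv phi], and [g] is only shown to decay, not to be Schwartz. This is
    why [f] is [reg_integral]: its value at [fourier g] is [gauss_const * g 0], whatever the
    integrability of [fourier g]. [schwartz] asks for partial derivatives and bounds only, so even
    the measurability of Schwartz functions must be derived, by way of a Lipschitz estimate. *)

Lemma measurable_affine (a b : R) :
  measurable_fun [set: R] (fun t : R => (a * t + b)%R).
Proof. by apply: measurable_funD => //; exact: mulrl_measurable. Qed.

(** Both sides are measures in [A], so uniqueness of Lebesgue measure reduces the claim to half-open
    intervals. A negative [a] flips the interval and moves its closed end, which does not change its
    length. *)
Lemma lebesgue_affine (a b : R) : (a != 0)%R ->
  forall A, measurable A ->
    leb A = `|a|%:E * leb ((fun t : measurableTypeR R => (a * t + b)%R : measurableTypeR R) @^-1` A).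
Proof.
move=> a0.
have a0' : (0 <= `|a|)%R by [].
pose phi := (fun t : measurableTypeR R => (a * t + b)%R : measurableTypeR R).
have mphi : measurable_fun setT phi by exact: measurable_affine.
pose m := measure_function_pushforward__canonical__measure_function_Measure
  leb mphi.
apply: (@lebesgue_measure_unique R (mscale (NngNum a0') m)) => X [[u v] /= _ <-].
rewrite [RHS](_ : _ = `|a|%:E * leb (phi @^-1` `]u, v])); last first.
  by rewrite /mscale.
have [a_gt0|a_lt0] : (0 < a \/ a < 0)%R.
  by case: (ltgtP a 0%R) a0 => // h _; [right|left].
- have -> : phi @^-1` `]u, v] = (`]((u - b) / a)%R, ((v - b) / a)%R]%classic : set R).
    apply/seteqP; split => t /=; rewrite !in_itv/= /phi.
      by rewrite ltr_pdivrMr// ler_pdivlMr// [(t * a)%R]mulrC; lra.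
    by rewrite ltr_pdivrMr// ler_pdivlMr// [(t * a)%R]mulrC; lra.
  rewrite !lebesgue_measure_itv/= !lte_fin ltr_pM2r ?invr_gt0// ltrD2r.
  case: ifPn => _; last by rewrite mule0.
  rewrite -!EFinB -EFinM gtr0_norm//; congr EFin; field; exact: lt0r_neq0.
- have -> : phi @^-1` `]u, v] = (`[((v - b) / a)%R, ((u - b) / a)%R[%classic : set R).
    apply/seteqP; split => t /=; rewrite !in_itv/= /phi.
      by rewrite ltr_ndivlMr// ler_ndivrMr// [(t * a)%R]mulrC; lra.
    by rewrite ltr_ndivlMr// ler_ndivrMr// [(t * a)%R]mulrC; lra.
  rewrite !lebesgue_measure_itv/= !lte_fin ltr_nM2r ?invr_lt0// ltrD2r.
  case: ifPn => _; last by rewrite mule0.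
  by rewrite -!EFinB -EFinM ltr0_norm//; congr EFin; field.
Qed.

Lemma ge0_integral_affine (a b : R) (f : measurableTypeR R -> \bar R) :
  (a != 0)%R -> measurable_fun setT f -> (forall t, 0 <= f t) ->
  \int[leb]_t f (a * t + b)%R = (`|a|^-1)%:E * \int[leb]_t f t.
Proof.
move=> a0 mf f0.
have a0' : (0 <= `|a|)%R by [].
pose phi := (fun t : measurableTypeR R => (a * t + b)%R : measurableTypeR R).
have mphi : measurable_fun setT phi by exact: measurable_affine.
pose m := measure_function_pushforward__canonical__measure_function_Measure
  leb mphi.
transitivity (\int[m]_t f t).
  by rewrite ge0_integral_pushforward// preimage_setT.
rewrite -[LHS]mul1e.
have -> : 1 = (`|a|^-1)%:E * `|a|%:E :> \bar R.
  by rewrite -EFinM mulVf// normr_eq0.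
rewrite -muleA; congr (_ * _).
rewrite -(@ge0_integral_mscale _ _ R m setT measurableT (NngNum a0') f)//.
apply: eq_measure_integral => A mA _.
exact/esym/(lebesgue_affine b a0 mA).
Qed.


Lemma cons_rVl n (p : 'rV[R]_n * measurableTypeR R) j :
  cons_rV p ord0 (@lshift 1 n j) = p.2.
Proof. by rewrite /cons_rV (@row_mxEl _ 1 1 n) mxE. Qed.

Lemma cons_rVr n (p : 'rV[R]_n * measurableTypeR R) j :
  cons_rV p ord0 (@rshift 1 n j) = p.1 ord0 j.
Proof. by rewrite /cons_rV (@row_mxEr _ 1 1 n). Qed.

(** The cube [A^n]. Its measure is explicit, which serves both the sigma-finite exhaustion and the
    dyadic shells. *)
Definition box {n} (A : set R) : set 'rV[R]_n :=
  [set x | forall i, A (x ord0 i)].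

Lemma measurable_box n (A : set (measurableTypeR R)) : measurable A ->
  measurable (@box n A).
Proof.
move=> mA.
have -> : @box n A = \bigcap_(i in [set: 'I_n])
    (fun x : 'rV[R]_n => x ord0 i : measurableTypeR R) @^-1` A.
  by apply/seteqP; split => x /= h i; [move=> _; exact: h|exact: h].
apply: fin_bigcap_measurable => // i _.
rewrite -[X in measurable X]setTI; exact: measurable_coord_rV.
Qed.

Lemma lebesgue_rV_box n (A : set (measurableTypeR R)) : measurable A ->
  lebesgue_rV R n (box A) = (leb A) ^+ n.
Proof.
move=> mA; elim: n => [|n ih].
  rewrite expe0 /= diracE mem_set//; by case.
rewrite lebesgue_rVS /pushforward.
have -> : (@cons_rV R n) @^-1` (box A) = box A `*` A.
  apply/seteqP; split => -[x t] /=.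
    move=> h; split => /= [i|].
      by have := h (rshift 1 i); rewrite cons_rVr.
    by have := h (@lshift 1 n ord0); rewrite cons_rVl.
  move=> [h ht] i; case: (@split_ordP 1 n i) => j ->.
    by rewrite cons_rVl.
  by rewrite cons_rVr.
by rewrite product_measure1E ?ih ?expeS 1?muleC//; exact: measurable_box.
Qed.

Lemma sigma_finite_lebesgue_rV n : sigma_finite setT (lebesgue_rV R n).
Proof.
exists (fun k => box `[(- k%:R)%R, k%:R%R]%classic).
  apply/seteqP; split => // x _.
  pose M := (\sum_i `|x ord0 i|)%R.
  have M0 : (0 <= M)%R by apply: sumr_ge0.
  exists (Num.bound M) => // i /=.
  have : (`|x ord0 i| <= M)%R by rewrite /M (bigD1 i)//= lerDl sumr_ge0.
  have := archi_boundP M0; rewrite in_itv /= -ler_norml => h1 h2.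
  exact: (le_trans h2 (ltW h1)).
move=> k; split; first exact: measurable_box.
rewrite lebesgue_rV_box//= lebesgue_measure_itv/=; case: ifPn => _.
  by rewrite -EFinD -EFin_expe ltry.
by rewrite -EFin_expe ltry.
Qed.

(* A named function, so that it can carry the sigma-finite structure. *)
Definition sleb n : set 'rV[R]_n -> \bar R := lebesgue_rV R n.

HB.instance Definition _ n := Measure.copy (@sleb n) (lebesgue_rV R n).

HB.instance Definition _ n := @Measure_isSigmaFinite.Build _ _ R
  (@sleb n) (@sigma_finite_lebesgue_rV n).

(** Tonelli for the product in the recursive definition of [lebesgue_rV]; every induction on the
    dimension goes through it. *)
Lemma ge0_integral_rVS n (f : 'rV[R]_n.+1 -> \bar R) :
  measurable_fun setT f -> (forall x, 0 <= f x) ->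
  \int[lebesgue_rV R n.+1]_x f x =
  \int[lebesgue_rV R n]_x \int[leb]_t f (cons_rV (x, t)).
Proof.
move=> mf f0.
transitivity (\int[sleb (n:=n) \x leb]_z (f \o @cons_rV R n) z).
  rewrite [LHS](@ge0_integral_pushforward _ _ _ _ R _ (@measurable_cons_rV R n)
  (lebesgue_rV R n \x leb) setT f)// preimage_setT.
apply: (@fubini_tonelli1 _ _ _ _ R (@sleb n) leb (f \o @cons_rV R n)) => //.
by apply: measurableT_comp => //; exact: measurable_cons_rV.
by move=> x; exact: f0.
Qed.

Lemma measurable_affine_rV n (a : R) (b : 'rV[R]_n) :
  measurable_fun setT (fun x : 'rV[R]_n => (a *: x + b)%R).
Proof.
apply: measurable_fun_rV => i.
rewrite (_ : (fun _ => _) = (fun t : R => (a * t + b ord0 i)%R) \o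
   (fun x : 'rV[R]_n => x ord0 i)); last first.
  by apply/funext => x /=; rewrite !mxE.
by apply: measurableT_comp; [exact: measurable_affine|exact: measurable_coord_rV].
Qed.

Lemma ge0_integral_rV_affine n (a : R) (b : 'rV[R]_n) (f : 'rV[R]_n -> \bar R) :
  (a != 0)%R -> measurable_fun setT f -> (forall x, 0 <= f x) ->
  \int[lebesgue_rV R n]_x f (a *: x + b)%R =
  (`|a|^-1 ^+ n)%:E * \int[lebesgue_rV R n]_x f x.
Proof.
move=> a0; elim: n b f => [|n ih] b f mf f0.
  rewrite expr0 mul1e; apply: eq_integral => x _.
  by rewrite [(_ + _)%R]thinmx0 [x]thinmx0.
rewrite ge0_integral_rVS//; last first.
  apply: measurableT_comp => //; exact: measurable_affine_rV.
rewrite ge0_integral_rVS//.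
pose b' : 'rV[R]_n := \row_i b ord0 (rshift 1 i).
pose F x := \int[leb]_t f (cons_rV (x, t)).
have mF : measurable_fun setT F.
  apply: (measurable_fun_fubini_tonelli_F (f \o @cons_rV R n)) => //.
    by apply: measurableT_comp => //; exact: measurable_cons_rV.
  by move=> x; exact: f0.
have F0 x : 0 <= F x by exact: integral_ge0.
(* The one-dimensional substitution is made in the inner integral, with the head coordinate of [b];
   the tail [b'] is left for the induction hypothesis. *)
transitivity (\int[lebesgue_rV R n]_x ((`|a|^-1)%:E * F (a *: x + b')%R)).
  apply: eq_integral => x _.
  rewrite -(@ge0_integral_affine a (b ord0 (@lshift 1 n ord0))
     (fun t => f (cons_rV ((a *: x + b')%R, t))))//; last first.
    apply: measurableT_comp => //.
    by apply: measurableT_comp; [exact: measurable_cons_rV|].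
  apply: eq_integral => t _; congr f.
  apply/rowP => i; rewrite [LHS]mxE [X in (X + _)%R]mxE.
  case: (@split_ordP 1 n i) => j ->; first by rewrite !cons_rVl (ord1 j).
  by rewrite !cons_rVr !mxE.
rewrite ge0_integralZl//; last exact: (measurableT_comp mF (measurable_affine_rV a b')).
by rewrite ih// muleA -EFinM exprS.
Qed.

Lemma integrable_rV_affine n (a : R) (b : 'rV[R]_n) (f : 'rV[R]_n -> R) :
  (a != 0)%R -> (lebesgue_rV R n).-integrable setT (EFin \o f) ->
  (lebesgue_rV R n).-integrable setT (fun x => (f (a *: x + b)%R)%:E).
Proof.
move=> a0 /integrableP[mf foo]; apply/integrableP; split.
  exact: (measurableT_comp mf (measurable_affine_rV a b)).
rewrite (ge0_integral_rV_affine b (f := fun x => `|(f x)%:E|))//.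
  by rewrite lte_mul_pinfty// lee_fin exprn_ge0// invr_ge0.
exact: measurableT_comp.
Qed.

Lemma Rintegral_rV_affine n (a : R) (b : 'rV[R]_n) (f : 'rV[R]_n -> R) :
  (a != 0)%R -> (lebesgue_rV R n).-integrable setT (EFin \o f) ->
  (\int[lebesgue_rV R n]_x f (a *: x + b) =
   `|a|^-1 ^+ n * \int[lebesgue_rV R n]_x f x)%R.
Proof.
move=> a0 intf; have /integrableP[mf _] := intf.
rewrite /Rintegral integralE [in RHS]integralE.
have mp := measurable_funepos mf; have mn := measurable_funeneg mf.
transitivity (fine (\int[lebesgue_rV R n]_x (EFin \o f)^\+ (a *: x + b)%R -
  \int[lebesgue_rV R n]_x (EFin \o f)^\- (a *: x + b)%R)).
  congr (fine (_ - _)); apply: eq_integral => x _.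
    by rewrite !funeposE.
  by rewrite !funenegE.
rewrite (ge0_integral_rV_affine b (f := (EFin \o f)^\+))//.
rewrite (ge0_integral_rV_affine b (f := (EFin \o f)^\-))//.
have fp : \int[lebesgue_rV R n]_x ((EFin \o f)^\+) x \is a fin_num.
  exact: integrable_pos_fin_num.
have fn : \int[lebesgue_rV R n]_x ((EFin \o f)^\-) x \is a fin_num.
  exact: integrable_neg_fin_num.
rewrite -muleBr//; last exact: fin_num_adde_defr.
by rewrite fineM// fin_numB fp.
Qed.

Lemma integrable_oneDsqrV : leb.-integrable setT (fun t => ((oneDsqr t)^-1)%:E).
Proof.
have mf : measurable_fun [set: R] (fun t : R => ((oneDsqr t)^-1)%:E).
  apply/measurable_EFinP; apply: continuous_measurable_fun.
  exact: continuous_oneDsqrV.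
have f0 (t : R) : (0 <= (oneDsqr t)^-1)%R.
  by rewrite invr_ge0 (le_trans ler01)// oneDsqr_ge1.
apply/integrableP; split => //.
under eq_integral do rewrite gee0_abs ?lee_fin//.
rewrite ge0_symfun_integralT//=.
- rewrite (_ : [set x | _] = `[0%R, +oo[%classic); last first.
    by apply/seteqP; split => x/=; rewrite in_itv/= andbT.
  by rewrite integral0y_oneDsqr -EFinM ltry.
- exact: continuous_oneDsqrV.
- by move=> x/=; rewrite /oneDsqr sqrrN.
Qed.

Lemma measurable_coordR n (i : 'I_n) :
  measurable_fun setT (fun x : 'rV[R]_n => x ord0 i : R).
Proof. exact: measurable_coord_rV. Qed.

Lemma measurable_dotv d (T : measurableType d) n (f g : T -> 'rV[R]_n) :
  measurable_fun setT f -> measurable_fun setT g ->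
  measurable_fun setT (fun x => dotv (f x) (g x)).
Proof.
move=> mf mg; rewrite /dotv.
apply: measurable_sum => i; apply: measurable_funM.
  exact: (measurableT_comp (measurable_coordR i)).
exact: (measurableT_comp (measurable_coordR i)).
Qed.

Definition sqn {n} (x : 'rV[R]_n) : R := (1 + dotv x x)%R.

Lemma dotv_ge0 n (x : 'rV[R]_n) : (0 <= dotv x x)%R.
Proof. by apply: sumr_ge0 => i _; rewrite -expr2 sqr_ge0. Qed.

Lemma sqn_ge1 n (x : 'rV[R]_n) : (1 <= sqn x)%R.
Proof. by rewrite lerDl dotv_ge0. Qed.

Lemma sqn_gt0 n (x : 'rV[R]_n) : (0 < sqn x)%R.
Proof. exact: lt_le_trans (sqn_ge1 x). Qed.

Lemma measurable_sqn n : measurable_fun setT (@sqn n).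
Proof. by apply: measurable_funD => //; exact: measurable_dotv. Qed.

Lemma oneDsqr_le_sqn n (x : 'rV[R]_n) i : (oneDsqr (x ord0 i) <= sqn x)%R.
Proof.
rewrite /oneDsqr /sqn lerD2l /dotv (bigD1 i)//= expr2 lerDl.
by apply: sumr_ge0 => j _; rewrite -expr2 sqr_ge0.
Qed.

Lemma integrable_prod_oneDsqrV n : (lebesgue_rV R n).-integrable setT
  (fun x => (\prod_(i < n) (oneDsqr (x ord0 i))^-1)%R%:E).
Proof.
have p0 (t : R) : (0 <= (oneDsqr t)^-1)%R.
  by rewrite invr_ge0 (le_trans ler01)// oneDsqr_ge1.
have P0 m (x : 'rV[R]_m) : (0 <= \prod_(i < m) (oneDsqr (x ord0 i))^-1)%R.
  by apply: prodr_ge0 => i _.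
have mP m : measurable_fun setT (fun x : 'rV[R]_m =>
    (\prod_(i < m) (oneDsqr (x ord0 i))^-1)%R).
  apply: measurable_prod => i _.
  have mo : measurable_fun setT (fun t : R => ((oneDsqr t)^-1)%R).
    by apply: continuous_measurable_fun; exact: continuous_oneDsqrV.
  exact: (measurableT_comp mo (measurable_coordR i)).
apply/integrableP; split; first by apply/measurable_EFinP; exact: mP.
under eq_integral do rewrite gee0_abs ?lee_fin//.
elim: n => [|n ih].
  under eq_integral do rewrite big_ord0.
  by rewrite integral_cst//= diracT mule1 ltry.
have h : \int[leb]_t ((oneDsqr t)^-1)%:E < +oo.
  have /integrableP[_] := integrable_oneDsqrV.
  by under eq_integral do rewrite /= ger0_norm//.
rewrite ge0_integral_rVS//; last 2 first.
- by apply/measurable_EFinP; exact: mP.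
- by move=> x; rewrite lee_fin.
set c := integral _ _ _ in h.
rewrite (_ : integral _ _ _ = \int[lebesgue_rV R n]_x
   (c * (\prod_(i < n) (oneDsqr (x ord0 i))^-1)%R%:E)).
  have c0 : 0 <= c by apply: integral_ge0 => t _; rewrite lee_fin.
  rewrite -[c]fineK ?ge0_fin_numE//.
  rewrite ge0_integralZl//; last 3 first.
  - by apply/measurable_EFinP; exact: mP.
  - by move=> x; rewrite lee_fin.
  - by rewrite lee_fin fine_ge0.
  by rewrite lte_mul_pinfty// lee_fin fine_ge0.
apply: eq_integral => x _.
rewrite /c -ge0_integralZr//; last 2 first.
- apply/measurable_EFinP; apply: continuous_measurable_fun.
  exact: continuous_oneDsqrV.
- by rewrite lee_fin.
apply: eq_integral => t _; rewrite -EFinM; congr EFin.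
rewrite (@big_split_ord _ _ _ 1 n)/= big_ord1 cons_rVl; congr (_ * _)%R.
by apply: eq_bigr => i _; rewrite cons_rVr.
Qed.

(** One factor [(sqn x)^-1] is spent on each coordinate, since [1 + x_i^2 <= sqn x]; the product
    then separates. The power [n] is larger than optimal, but rapidly decaying functions can afford
    it, and it is the standard dominating function below. *)
Lemma integrable_sqnV n : (lebesgue_rV R n).-integrable setT
  (fun x => ((sqn x) ^- n)%:E).
Proof.
apply: le_integrable (integrable_prod_oneDsqrV n) => //.
  apply/measurable_EFinP.
  rewrite (_ : (fun _ => _) = (@powR R ^~ (- n%:R)%R) \o @sqn n); last first.
    by apply/funext => x /=; rewrite powRN powR_mulrn// ltW// sqn_gt0.
  exact: (measurableT_comp (measurable_powR _) (@measurable_sqn n)).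
have p0 (x : 'rV[R]_n) : (0 <= \prod_(i < n) (oneDsqr (x ord0 i))^-1)%R.
  by apply: prodr_ge0 => i _; rewrite invr_ge0 (le_trans ler01)// oneDsqr_ge1.
have q0 (x : 'rV[R]_n) : (0 <= sqn x ^- n)%R.
  by rewrite invr_ge0 exprn_ge0// ltW// sqn_gt0.
move=> x _ /=; rewrite lee_fin !ger0_norm//.
rewrite -exprVn.
have -> : ((sqn x)^-1 ^+ n = \prod_(i < n) (sqn x)^-1)%R.
  by rewrite prodr_const card_ord.
apply: ler_prod => i _; rewrite invr_ge0 ltW ?sqn_gt0//=.
rewrite lef_pV2 ?posrE ?sqn_gt0 ?oneDsqr_le_sqn//.
Qed.

End lebesgue_rV_theory.

(** * Complex-valued integrals *)

Section complex_basics.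
Context {R : realType}.
Implicit Types z w : R[i].

Lemma Re_add z w : complex.Re (z + w) = complex.Re z + complex.Re w.
Proof. by case: z w => [a b] [c d]. Qed.

Lemma Im_add z w : complex.Im (z + w) = complex.Im z + complex.Im w.
Proof. by case: z w => [a b] [c d]. Qed.

Lemma Re_mul z w : complex.Re (z * w) =
  complex.Re z * complex.Re w - complex.Im z * complex.Im w.
Proof. by case: z w => [a b] [c d]. Qed.

Lemma Im_mul z w : complex.Im (z * w) =
  complex.Re z * complex.Im w + complex.Im z * complex.Re w.
Proof. by case: z w => [a b] [c d]. Qed.

Lemma complex_ext z w : complex.Re z = complex.Re w ->
  complex.Im z = complex.Im w -> z = w.
Proof. by case: z w => [a b] [c d] /= -> ->. Qed.

Lemma cmodE z : cmod z = Num.sqrt (complex.Re z ^+ 2 + complex.Im z ^+ 2).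
Proof. by rewrite /cmod normc_def. Qed.

Lemma cmod_ge0 z : 0 <= cmod z.
Proof. by rewrite cmodE sqrtr_ge0. Qed.

Lemma cmod_C z : (cmod z)%:C%C = `|z|.
Proof. by rewrite /cmod normc_def. Qed.

Lemma cmodM z w : cmod (z * w) = cmod z * cmod w.
Proof. by apply: complexI; rewrite rmorphM/= !cmod_C normrM. Qed.

Lemma cmodD z w : cmod (z + w) <= cmod z + cmod w.
Proof. by rewrite -lecR rmorphD/= !cmod_C ler_normD. Qed.

Lemma cmod_real (a : R) : cmod a%:C%C = `|a|.
Proof. by rewrite cmodE/= expr0n/= addr0 sqrtr_sqr. Qed.

Lemma normr_Re_le z : `|complex.Re z| <= cmod z.
Proof. by rewrite cmodE -sqrtr_sqr ler_wsqrtr// lerDl sqr_ge0. Qed.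

Lemma normr_Im_le z : `|complex.Im z| <= cmod z.
Proof. by rewrite cmodE -sqrtr_sqr ler_wsqrtr// lerDr sqr_ge0. Qed.

Lemma cmod_le z : cmod z <= `|complex.Re z| + `|complex.Im z|.
Proof.
rewrite cmodE -[leRHS]ger0_norm ?addr_ge0// -sqrtr_sqr ler_wsqrtr//.
rewrite sqrrD !real_normK ?num_real// -addrA [X in _ <= _ + X]addrC addrA lerDl.
by rewrite mulrn_wge0// mulr_ge0.
Qed.

Lemma cmod_eq0 z : cmod z = 0 -> z = 0.
Proof.
move=> z0; apply: complex_ext; apply/eqP; rewrite -normr_le0 -z0.
  exact: normr_Re_le.
exact: normr_Im_le.
Qed.

Lemma cmod_cis (a : R) : cmod (cis a) = 1.
Proof. by rewrite cmodE /cis/= cos2Dsin2 sqrtr1. Qed.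

Lemma cisD (a b : R) : cis (a + b) = cis a * cis b.
Proof.
by apply: complex_ext; rewrite ?Re_mul ?Im_mul/= ?cosD// sinD addrC.
Qed.

Lemma cis0 : cis 0 = 1 :> R[i].
Proof. by rewrite /cis cos0 sin0. Qed.

End complex_basics.

Section cint_theory.
Context {R : realType} {n : nat}.
Local Notation V := 'rV[R]_n.
Local Notation mu := (@lebesgue_rV R n).
Implicit Types f g : V -> R[i].

Lemma cmeasurableM f g : cmeasurable f -> cmeasurable g ->
  cmeasurable (fun x => f x * g x).
Proof.
move=> [f1 f2] [g1 g2]; split.
  rewrite (_ : (fun _ => _) = (fun x => complex.Re (f x) * complex.Re (g x) -
    complex.Im (f x) * complex.Im (g x))); last first.
    by apply/funext => x; rewrite Re_mul.
  by apply: measurable_funB; apply: measurable_funM.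
rewrite (_ : (fun _ => _) = (fun x => complex.Re (f x) * complex.Im (g x) +
    complex.Im (f x) * complex.Re (g x))); last first.
    by apply/funext => x; rewrite Im_mul.
by apply: measurable_funD; apply: measurable_funM.
Qed.

Lemma cmeasurable_cst (c : R[i]) : @cmeasurable R n (fun=> c).
Proof. by split; exact: measurable_cst. Qed.

Lemma cmeasurable_real (u : V -> R) : measurable_fun setT u ->
  cmeasurable (fun x => (u x)%:C%C).
Proof. by move=> mu; split => //=; exact: measurable_cst. Qed.

Lemma cmeasurable_cis (u : V -> R) : measurable_fun setT u ->
  cmeasurable (fun x => cis (u x)).
Proof.
move=> mu; split.
  apply: (measurableT_comp (f := cos)) mu.
  by apply: continuous_measurable_fun; exact: continuous_cos.
apply: (measurableT_comp (f := sin)) mu.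
by apply: continuous_measurable_fun; exact: continuous_sin.
Qed.

Lemma measurable_cmod f : cmeasurable f -> measurable_fun setT (fun x => cmod (f x)).
Proof.
move=> [f1 f2]; rewrite (_ : (fun _ => _) =
  (@Num.sqrt R) \o (fun x => complex.Re (f x) ^+ 2 + complex.Im (f x) ^+ 2)); last first.
  by apply/funext => x; rewrite cmodE.
apply: measurableT_comp.
  by apply: continuous_measurable_fun; exact: sqrt_continuous.
by apply: measurable_funD; apply: measurable_funX.
Qed.

Lemma cintegrable_meas f : cintegrable f -> cmeasurable f.
Proof.
by move=> [f1 f2]; split; apply/measurable_EFinP; exact: (measurable_int mu).
Qed.

Lemma cintegrable_le f (g : V -> R) : cmeasurable f ->
  mu.-integrable setT (EFin \o g) -> (forall x, cmod (f x) <= g x) ->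
  cintegrable f.
Proof.
move=> [f1 f2] intg fg; split; apply: le_integrable intg => //.
- exact/measurable_EFinP.
- move=> x _ /=; rewrite lee_fin (le_trans (normr_Re_le _))//.
  by rewrite (le_trans (fg x))// ler_norm.
- exact/measurable_EFinP.
- move=> x _ /=; rewrite lee_fin (le_trans (normr_Im_le _))//.
  by rewrite (le_trans (fg x))// ler_norm.
Qed.

Lemma integrable_cmod f : cintegrable f ->
  mu.-integrable setT (fun x => (cmod (f x))%:E).
Proof.
move=> intf; have [f1 f2] := intf.
have := integrableD measurableT (integrable_norm f1) (integrable_norm f2).
apply: le_integrable => //.
  by apply/measurable_EFinP; apply: measurable_cmod; exact: cintegrable_meas.
move=> x _ /=; rewrite lee_fin ger0_norm ?cmod_ge0//.
by rewrite (le_trans (cmod_le _))// ler_norm.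
Qed.

Lemma cintegrableP f : cmeasurable f ->
  (\int[mu]_x (cmod (f x))%:E < +oo)%E -> cintegrable f.
Proof.
move=> mf foo; apply: (@cintegrable_le f (fun x => cmod (f x))) => //.
apply/integrableP; split; first by apply/measurable_EFinP; exact: measurable_cmod.
by under eq_integral do rewrite /= ger0_norm ?cmod_ge0//.
Qed.

Lemma cintegrableM_bounded f g (M : R) : cintegrable f -> cmeasurable g ->
  (forall x, cmod (g x) <= M) -> cintegrable (fun x => g x * f x).
Proof.
move=> intf mg gM; apply: (@cintegrable_le _ (fun x => M * cmod (f x))).
- by apply: cmeasurableM => //; exact: cintegrable_meas.
- rewrite (_ : _ \o _ = (fun x => M%:E * (cmod (f x))%:E)%E)//.
  by apply: integrableZl => //; exact: integrable_cmod.
- by move=> x; rewrite cmodM ler_wpM2r ?cmod_ge0.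
Qed.

Lemma cintegrableZ (c : R[i]) f : cintegrable f -> cintegrable (fun x => c * f x).
Proof.
move=> intf; apply: (@cintegrableM_bounded f (fun=> c) (cmod c)) => //.
Qed.

Lemma cintegrableD f g : cintegrable f -> cintegrable g ->
  cintegrable (fun x => f x + g x).
Proof.
move=> [f1 f2] [g1 g2]; split.
  under eq_fun do rewrite Re_add EFinD.
  exact: integrableD.
under eq_fun do rewrite Im_add EFinD.
exact: integrableD.
Qed.

Lemma cintD f g : cintegrable f -> cintegrable g ->
  cint (fun x => f x + g x) = cint f + cint g.
Proof.
move=> [f1 f2] [g1 g2]; apply: complex_ext; rewrite ?Re_add ?Im_add/=.
  by under eq_Rintegral do rewrite Re_add; rewrite RintegralD.
by under eq_Rintegral do rewrite Im_add; rewrite RintegralD.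
Qed.

Lemma cintZ (c : R[i]) f : cintegrable f ->
  cint (fun x => c * f x) = c * cint f.
Proof.
move=> [f1 f2].
have Z (r : R) (u : V -> R) : mu.-integrable setT (fun x => (u x)%:E) ->
    mu.-integrable setT (EFin \o (fun x => r * u x)).
  by move=> iu; exact: (integrableZl measurableT r iu).
apply: complex_ext; rewrite ?Re_mul ?Im_mul/=.
  under eq_Rintegral do rewrite Re_mul.
  by rewrite RintegralB//; [rewrite !RintegralZl|exact: Z|exact: Z].
under eq_Rintegral do rewrite Im_mul.
by rewrite RintegralD//; [rewrite !RintegralZl|exact: Z|exact: Z].
Qed.

Lemma cint_real (u : V -> R) :
  cint (fun x => (u x)%:C%C) = (\int[mu]_x u x)%:C%C.
Proof.
apply: complex_ext => //=.
by rewrite Rintegral_cst// mul0r.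
Qed.

(* The sharp constant is 1; the factor 2 comes from bounding the real and
   imaginary parts separately. *)
Lemma cmod_cint_le f : cintegrable f ->
  cmod (cint f) <= 2 * \int[mu]_x cmod (f x).
Proof.
move=> intf; have [f1 f2] := intf; have intm := integrable_cmod intf.
rewrite (le_trans (cmod_le _))//= mulr_natl mulr2n lerD//.
  rewrite (le_trans (le_normr_Rintegral measurableT f1))// le_Rintegral//.
    exact: integrable_norm.
  by move=> x _; exact: normr_Re_le.
rewrite (le_trans (le_normr_Rintegral measurableT f2))// le_Rintegral//.
  exact: integrable_norm.
by move=> x _; exact: normr_Im_le.
Qed.

Lemma cint_affine (a : R) (b : V) f : a != 0 -> cintegrable f ->
  cint (fun x => f (a *: x + b)) = (`|a|^-1 ^+ n)%:C%C * cint f.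
Proof.
move=> a0 [f1 f2]; apply: complex_ext; rewrite ?Re_mul ?Im_mul/= mul0r ?subr0 ?addr0.
  exact: (Rintegral_rV_affine b a0 (f := fun x => complex.Re (f x))).
exact: (Rintegral_rV_affine b a0 (f := fun x => complex.Im (f x))).
Qed.

End cint_theory.

(** * Componentwise convergence of complex sequences *)

Section ccvg.
Context {R : realType}.
Implicit Types (u v : nat -> R[i]) (l m : R[i]).

Definition ccvg u l : Prop :=
  ((fun k => complex.Re (u k)) @ \oo --> complex.Re l) /\
  ((fun k => complex.Im (u k)) @ \oo --> complex.Im l).

Lemma ccvg_unique u l m : ccvg u l -> ccvg u m -> l = m.
Proof.
move=> [a b] [c d]; apply: complex_ext.
  exact: cvg_unique a c.
exact: cvg_unique b d.
Qed.

Lemma ccvg_cst l : ccvg (fun=> l) l.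
Proof. by split; exact: cvg_cst. Qed.

Lemma ccvgM u v l m : ccvg u l -> ccvg v m -> ccvg (fun k => u k * v k) (l * m).
Proof.
move=> [a b] [c d]; split.
  under eq_fun do rewrite Re_mul.
  by rewrite Re_mul; apply: cvgB; apply: cvgM.
under eq_fun do rewrite Im_mul.
by rewrite Im_mul; apply: cvgD; apply: cvgM.
Qed.

Lemma ccvg_real (u : nat -> R) (l : R) : u @ \oo --> l ->
  ccvg (fun k => (u k)%:C%C) l%:C%C.
Proof. by move=> ul; split => //=; exact: cvg_cst. Qed.

Lemma ccvg_cis (u : nat -> R) (l : R) : u @ \oo --> l ->
  ccvg (fun k => cis (u k)) (cis l).
Proof.
move=> ul; split => /=; apply: continuous_cvg => //.
  exact: continuous_cos.
exact: continuous_sin.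
Qed.

End ccvg.

(** * Dominated convergence and Fubini for complex integrands *)

Section integral_theorems.
Context {R : realType} {n : nat}.
Local Notation V := 'rV[R]_n.
Local Notation mu := (@lebesgue_rV R n).
Implicit Types f g : V -> R[i].

Lemma dominated_cint (F : nat -> V -> R[i]) f (g : V -> R) :
  (forall k, cmeasurable (F k)) -> cmeasurable f ->
  mu.-integrable setT (EFin \o g) ->
  (forall x, ccvg (F ^~ x) (f x)) -> (forall k x, cmod (F k x) <= g x) ->
  ccvg (fun k => cint (F k)) (cint f).
Proof.
move=> mF [mf1 mf2] intg Ff Fg.
suff H (G : nat -> V -> R) (h : V -> R) :
    (forall k, measurable_fun setT (G k)) -> measurable_fun setT h ->
    (forall x, G ^~ x @ \oo --> h x) ->
    (forall k x, `|G k x| <= g x) ->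
    (fun k => \int[mu]_x G k x) @ \oo --> \int[mu]_x h x.
  split; apply: H => //.
  - by move=> k; have [] := mF k.
  - by move=> x; have [] := Ff x.
  - by move=> k x; rewrite (le_trans (normr_Re_le _)).
  - by move=> k; have [] := mF k.
  - by move=> x; have [] := Ff x.
  - by move=> k x; rewrite (le_trans (normr_Im_le _)).
move=> mG mh Gh Gg; apply: fine_cvg.
have H1 k : measurable_fun setT (fun x => (G k x)%:E).
  by apply/measurable_EFinP; exact: mG.
have H2 : measurable_fun setT (EFin \o h) by exact/measurable_EFinP.
have H3 : {ae mu, forall x, setT x ->
    (fun k => (G k x)%:E) @ \oo --> (EFin \o h) x}.
  by apply: aeW => x _; apply: cvg_EFin; [exact: nearW|exact: Gh].
have H4 : {ae mu, forall x, forall k, setT x -> (`|(G k x)%:E| <= (EFin \o g) x)%E}.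
  by apply: aeW => x k _; rewrite lee_fin.
have [inth _ cvgI] := dominated_convergence measurableT H1 H2 H3 intg H4.
by rewrite fineK//; exact: integrable_fin_num.
Qed.

(** Tonelli applies to the positive and negative parts, and [fine] is measurable, so sections with
    an infinite integral do no harm. *)
Lemma measurable_Rintegral (u : V * V -> R) : measurable_fun setT u ->
  measurable_fun setT (fun x => \int[mu]_y u (x, y)).
Proof.
move=> mu_.
apply: (measurableT_comp (f := fine)) => //.
have mE : measurable_fun setT (EFin \o u) by exact/measurable_EFinP.
rewrite (_ : (fun _ => _) = (fun x => \int[mu]_y (EFin \o u)^\+ (x, y) -
   \int[mu]_y (EFin \o u)^\- (x, y))%E); last first.
  apply/funext => x; rewrite integralE; congr (_ - _)%E; apply: eq_integral => y _.
    by rewrite !funeposE.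
  by rewrite !funenegE.
apply: emeasurable_funB.
  apply: (@measurable_fun_fubini_tonelli_F _ _ _ _ R (@sleb R n)) => //.
  exact: measurable_funepos.
apply: (@measurable_fun_fubini_tonelli_F _ _ _ _ R (@sleb R n)) => //.
exact: measurable_funeneg.
Qed.

Lemma integrable_scale (A : R) (B : V -> R) :
  mu.-integrable setT (EFin \o B) ->
  mu.-integrable setT (EFin \o (fun y => A * B y)).
Proof. by move=> iB; exact: (integrableZl measurableT A iB). Qed.

(** Domination by a product makes every section integrable, not just almost every one, so [fineK]
    applies pointwise when passing between real and extended integrals. *)
Lemma Rintegral_fubini (u : V * V -> R) (A B : V -> R) :
  measurable_fun setT u ->
  mu.-integrable setT (EFin \o A) -> mu.-integrable setT (EFin \o B) ->
  (forall x y, `|u (x, y)| <= A x * B y) ->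
  \int[mu]_x (\int[mu]_y u (x, y)) = \int[mu]_y (\int[mu]_x u (x, y)).
Proof.
move=> mu_ iA iB uAB.
have mE : measurable_fun setT (EFin \o u) by exact/measurable_EFinP.
have i1 x : mu.-integrable setT (fun y => (u (x, y))%:E).
  apply: le_integrable (integrable_scale (A x) iB) => //.
    by apply: (measurableT_comp mE).
  by move=> y _ /=; rewrite lee_fin (le_trans (uAB _ _))// ler_norm.
have i2 y : mu.-integrable setT (fun x => (u (x, y))%:E).
  apply: le_integrable (integrable_scale (B y) iA) => //.
    by apply: (measurableT_comp mE).
  by move=> x _ /=; rewrite lee_fin (le_trans (uAB _ _))// mulrC ler_norm.
have absE (C : V -> R) : mu.-integrable setT (EFin \o C) ->
    measurable_fun setT (fun x => `|C x|%:E).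
  move=> /integrableP[mC _]; apply/measurable_EFinP.
  by apply: measurableT_comp => //; exact/measurable_EFinP.
have mA := absE _ iA; have mB := absE _ iB.
(* Joint integrability: the iterated integral of the absolute value is at most the product of the
   integrals of [A] and [B] in absolute value. *)
have iu : (@sleb R n \x @sleb R n)%E.-integrable setT (EFin \o u).
  apply/(@integrable12ltyP _ _ _ _ R (@sleb R n) (@sleb R n)) => //.
  have : (\int[mu]_x (`|A x|%:E * \int[mu]_y `|B y|%:E) < +oo)%E.
    have /integrableP[_ ooB] := iB; have /integrableP[_ ooA] := iA.
    have B0 : (0 <= \int[mu]_y `|B y|%:E)%E by exact: integral_ge0.
    have bfin : (\int[mu]_y `|B y|%:E)%E \is a fin_num by rewrite ge0_fin_numE.
    have f0 : (0 <= (fine (\int[mu]_y `|B y|%:E))%:E)%E by rewrite fineK.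
    rewrite -(fineK bfin) ge0_integralZr//.
    by rewrite muleC lte_mul_pinfty.
  apply: le_lt_trans; apply: ge0_le_integral => //.
  - by move=> x _; apply: integral_ge0.
  - apply: (@measurable_fun_fubini_tonelli_F _ _ _ _ R (@sleb R n)
      (fun z => `|(u z)%:E|%E)) => //.
    exact: measurableT_comp.
  - exact: emeasurable_funM.
  move=> x _; rewrite -ge0_integralZl//.
  apply: ge0_le_integral => //.
  - apply: (measurableT_comp (f := abse)) => //.
    exact: (measurableT_comp mE (pair1_measurable x)).
  - exact: emeasurable_funM.
  - by move=> y _; rewrite /= -EFinM lee_fin -normrM (le_trans (uAB _ _))// ler_norm.
congr fine.
transitivity (\int[mu]_x \int[mu]_y (u (x, y))%:E)%E.
  by apply: eq_integral => x _; rewrite fineK//; exact: integrable_fin_num.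
rewrite (@Fubini _ _ _ _ R (@sleb R n) (@sleb R n) (EFin \o u) iu).
by apply: eq_integral => x _; rewrite fineK//; exact: integrable_fin_num.
Qed.

Lemma cint_fubini (k : V -> V -> R[i]) (A B : V -> R) :
  measurable_fun setT (fun z : V * V => complex.Re (k z.1 z.2)) ->
  measurable_fun setT (fun z : V * V => complex.Im (k z.1 z.2)) ->
  mu.-integrable setT (EFin \o A) -> mu.-integrable setT (EFin \o B) ->
  (forall x y, cmod (k x y) <= A x * B y) ->
  cint (fun x => cint (k x)) = cint (fun y => cint (k ^~ y)).
Proof.
move=> m1 m2 iA iB kAB; apply: complex_ext => /=.
  apply: (Rintegral_fubini m1 iA iB) => x y /=.
  exact: le_trans (normr_Re_le _) _.
apply: (Rintegral_fubini m2 iA iB) => x y /=.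
exact: le_trans (normr_Im_le _) _.
Qed.

End integral_theorems.

(** * Directional derivatives *)

Section lderiv.
Context {R : realType} {n : nat}.
Local Notation V := 'rV[R]_n.
Implicit Types (f g df dg : V -> R) (v x y : V).

(* Differentiability along the lines of direction v, in terms of functions of
   one real variable, for which the chain rule is available. *)
Definition lderiv v f df : Prop :=
  forall x, is_derive (0 : R) 1 (fun t : R => f (x + t *: v)) (df x).

(** A directional derivative depends only on its difference quotient, so it can be moved between a
    function on the space and its restriction to a line. *)
Lemma is_derive_quotient (V1 V2 : normedModType R) (f1 : V1 -> R) (f2 : V2 -> R)
    (a1 v1 : V1) (a2 v2 : V2) (d : R) :
  (fun h : R => h^-1 *: (f1 (h *: v1 + a1) - f1 a1)) =
  (fun h : R => h^-1 *: (f2 (h *: v2 + a2) - f2 a2)) ->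
  is_derive a1 v1 f1 d -> is_derive a2 v2 f2 d.
Proof.
move=> E [d1 e1]; apply: DeriveDef.
  by move: d1; rewrite /derivable E.
by move: e1; rewrite /derive -E.
Qed.

Lemma lderivP v f df : lderiv v f df <-> forall x, is_derive x v f (df x).
Proof.
split=> h x; have := h x; apply: is_derive_quotient; apply/funext => t;
  by rewrite scale0r !addr0 scaler1 [x + _]addrC.
Qed.

(** [lderiv] speaks of parameter 0 only; the mean value theorem and differentiation under the
    integral need every parameter on the line. *)
Lemma lderiv_line v f df : lderiv v f df -> forall x t,
  is_derive (t : R) 1 (fun r : R => f (x + r *: v)) (df (x + t *: v)).
Proof.
move=> h x t; have := h (x + t *: v); apply: is_derive_quotient.
apply/funext => r; rewrite scale0r !addr0 !scaler1 -addrA -scalerDl.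
by rewrite [t + _]addrC.
Qed.

Lemma lderivD v f g df dg : lderiv v f df -> lderiv v g dg ->
  lderiv v (fun x => f x + g x) (fun x => df x + dg x).
Proof. by move=> hf hg x; have := hf x; have := hg x => *; exact: is_deriveD. Qed.

Lemma lderivM v f g df dg : lderiv v f df -> lderiv v g dg ->
  lderiv v (fun x => f x * g x) (fun x => f x * dg x + g x * df x).
Proof.
move=> hf hg x; have h1 := hf x; have h2 := hg x.
have := is_deriveM h1 h2; rewrite scale0r addr0; exact.
Qed.

Lemma lderiv_cst v (c : R) : lderiv v (fun=> c) (fun=> 0).
Proof. by move=> x; exact: is_derive_cst. Qed.

Lemma lderivZ v (c : R) f df : lderiv v f df ->
  lderiv v (fun x => c * f x) (fun x => c * df x).
Proof.
move=> hf; have := lderivM (lderiv_cst v c) hf.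
by under [X in lderiv _ _ X]eq_fun do rewrite mulr0 addr0.
Qed.

Lemma lderiv_comp v f df (h dh : R -> R) : lderiv v f df ->
  (forall t, is_derive (t : R) 1 h (dh t)) ->
  lderiv v (fun x => h (f x)) (fun x => dh (f x) * df x).
Proof.
move=> hf hh x; have h1 := hf x.
have := @is_derive1_comp R h (fun t => f (x + t *: v)) 0 (dh (f x)) (df x).
by rewrite scale0r addr0; apply.
Qed.

Lemma lderiv_dotv v (xi : V) : lderiv v (fun x => dotv x xi) (fun=> dotv v xi).
Proof.
move=> x; rewrite (_ : (fun _ => _) = (fun t : R => dotv x xi + t * dotv v xi)).
  apply: is_derive_eq. rewrite /GRing.scale/=; ring.
apply/funext => t; rewrite /dotv mulr_sumr -big_split/=.
by apply: eq_bigr => i _; rewrite !mxE; ring.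
Qed.

Lemma lderiv_sq v : lderiv v (fun x => dotv x x) (fun x => 2 * dotv x v).
Proof.
move=> x; rewrite (_ : (fun _ => _) =
    (fun t : R => dotv x x + t * (2 * dotv x v) + t ^+ 2 * dotv v v)).
  apply: is_derive_eq. rewrite /GRing.scale/=; ring.
apply/funext => t; rewrite /dotv !mulr_sumr -!big_split/=.
by apply: eq_bigr => i _; rewrite !mxE; ring.
Qed.

End lderiv.

(** * From bounded partial derivatives to measurability *)

Section lipschitz.
Context {R : realType} {n : nat}.
Local Notation V := 'rV[R]_n.
Local Notation e_ i := (delta_mx ord0 i : V).

Lemma derive_bounded_lipschitz (g dg : R -> R) (B : R) :
  (forall t, is_derive (t : R) 1 g (dg t)) -> (forall t, `|dg t| <= B) ->
  forall a b, `|g b - g a| <= B * `|b - a|.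
Proof.
move=> hg hB a b; wlog ab : a b / a < b.
  move=> H; case: (ltgtP a b) => ab; first exact: H.
    by rewrite distrC [`|b - a|]distrC; exact: H.
  by rewrite ab !subrr normr0 mulr0.
have [c _ ->] : exists2 c, c \in `]a, b[ & g b - g a = dg c * (b - a).
  apply: MVT => //; apply: derivable_within_continuous => x _.
  by have [] := hg x.
by rewrite normrM ler_wpM2r.
Qed.

(** The point [y] is reached from [x] by changing one coordinate at a time, and the increments
    telescope. *)
Lemma lipschitz_coords (f : V -> R) (B : R) :
  (forall x i (t : R), `|f (x + t *: e_ i) - f x| <= B * `|t|) ->
  forall x y : V, `|f y - f x| <= B * \sum_i `|y ord0 i - x ord0 i|.
Proof.
move=> hf x y.
(* Stated for an arbitrary list of coordinates so that induction on the list applies. *)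
have H (c : 'I_n -> R) (s : seq 'I_n) :
    `|f (x + \sum_(i <- s) c i *: e_ i) - f x| <= B * \sum_(i <- s) `|c i|.
  elim: s => [|i s ih]; first by rewrite !big_nil addr0 subrr normr0 mulr0.
  rewrite !big_cons mulrDr [c i *: _ + _]addrC addrA.
  set z := x + _ in ih *.
  have -> : f (z + c i *: e_ i) - f x = (f (z + c i *: e_ i) - f z) + (f z - f x).
    by ring.
  by rewrite (le_trans (ler_normD _ _))// lerD.
have := H (fun i => y ord0 i - x ord0 i) (index_enum _).
rewrite (_ : x + _ = y)//.
have -> : \sum_i (y ord0 i - x ord0 i) *: e_ i = y - x.
  by rewrite [RHS]row_sum_delta; apply: eq_bigr => i _; rewrite !mxE.
by rewrite addrC subrK.
Qed.

Definition grid (k : nat) (z : 'rV[int]_n) : V := \row_i ((z ord0 i)%:~R / k.+1%:R).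

Definition floor_rV (k : nat) (x : V) : 'rV[int]_n :=
  \row_i Num.floor (k.+1%:R * x ord0 i).

Lemma measurable_floor_fiber (k : nat) (z : 'rV[int]_n) :
  measurable (floor_rV k @^-1` [set z]).
Proof.
have k0 : 0 < k.+1%:R :> R by rewrite ltr0n.
have -> : floor_rV k @^-1` [set z] = \bigcap_(i in [set: 'I_n])
   ((fun x : V => x ord0 i : R) @^-1`
     `[(z ord0 i)%:~R / k.+1%:R, (z ord0 i + 1)%:~R / k.+1%:R[%classic).
  apply/seteqP; split => x /=.
    move=> <- i _; rewrite /= in_itv/= mxE.
    by rewrite ler_pdivrMr// ltr_pdivlMr// mulrC floor_itv.
  move=> h; apply/rowP => i; have := h i I; rewrite /= in_itv/= mxE.
  rewrite ler_pdivrMr// ltr_pdivlMr// mulrC => /andP[h1 h2].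
  by apply: floor_def; rewrite h1.
apply: fin_bigcap_measurable => // i _.
by rewrite -[X in measurable X]setTI; apply: measurable_coordR.
Qed.

(** Sampling [f] at the lower corner of the lattice cell of mesh [1 / (k + 1)] gives a function that
    is constant on countably many measurable cells, and these functions converge to [f]. This stays
    within the product sigma-algebra, with no appeal to open sets of row vectors. *)
Lemma lipschitz_measurable (f : V -> R) (B : R) :
  (forall x y : V, `|f y - f x| <= B * \sum_i `|y ord0 i - x ord0 i|) ->
  measurable_fun setT f.
Proof.
move=> hf.
have B0 : 0 <= `|B| by [].
pose F k x := f (grid k (floor_rV k x)).
apply: (@measurable_fun_cvg _ _ _ setT F f) => //.
  move=> k _ Y mY; rewrite setTI.
  have -> : F k @^-1` Y = \bigcup_(z : 'rV[int]_n)
      ((floor_rV k @^-1` [set z]) `&` [set _ | Y (f (grid k z))]).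
    apply/seteqP; split => x /=.
      by move=> Yx; exists (floor_rV k x).
    by move=> [z _ [/= <-]].
  apply: countable_bigcupT_measurable => // z.
  apply: measurableI; first exact: measurable_floor_fiber.
  case: (pselect (Y (f (grid k z)))) => h.
    by rewrite (_ : [set _ | _] = setT)//; apply/seteqP; split.
  by rewrite (_ : [set _ | _] = set0)//; apply/seteqP; split.
move=> x _.
(* Each of the [n] coordinates moves by at most [1 / (k + 1)]. *)
have Fx k : `|F k x - f x| <= `|B| * (n%:R * k.+1%:R^-1).
  rewrite (le_trans (hf _ _))// (le_trans (ler_wpM2r _ (ler_norm B)))//.
    by apply: sumr_ge0.
  rewrite ler_wpM2l//.
  have -> : n%:R * k.+1%:R^-1 = \sum_(i < n) (k.+1%:R^-1 : R).
    by rewrite sumr_const card_ord mulr_natl.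
  apply: ler_sum => i _; rewrite !mxE.
  have k0 : 0 < k.+1%:R :> R by rewrite ltr0n.
  have /andP[h1 h2] := floor_itv (k.+1%:R * x ord0 i).
  have -> : (Num.floor (k.+1%:R * x ord0 i))%:~R / k.+1%:R - x ord0 i =
      ((Num.floor (k.+1%:R * x ord0 i))%:~R - k.+1%:R * x ord0 i) / k.+1%:R.
    by rewrite mulrBl mulrAC divff ?mul1r// lt0r_neq0.
  rewrite normrM [X in _ * X]gtr0_norm ?invr_gt0// -[leRHS]mul1r ler_wpM2r ?invr_ge0 ?ltW//.
  rewrite ltr_norml; move: h2; rewrite intrD => h2; apply/andP; split; lra.
apply/cvgrPdist_le => e e0; near=> k.
rewrite distrC (le_trans (Fx k))// mulrA ler_pdivrMr ?ltr0n// -ler_pdivrMl//.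
rewrite (@le_trans _ _ k%:R)//; last by rewrite ler_nat.
near: k; exact: nbhs_infty_ger.
Unshelve. all: by end_near. Qed.

End lipschitz.

(** * Schwartz functions *)

Section schwartz_theory.
Context {R : realType} {n : nat}.
Local Notation V := 'rV[R]_n.
Local Notation mu := (@lebesgue_rV R n).
Local Notation e_ i := (delta_mx ord0 i : V).
Implicit Types (phi psi : V -> R[i]) (x xi : V).

Lemma lderiv_cderivable phi i (u v : V -> R) :
  lderiv (e_ i) (fun x => complex.Re (phi x)) u ->
  lderiv (e_ i) (fun x => complex.Im (phi x)) v ->
  (forall x, cderivable phi x i) /\ cpartial i phi = (fun x => u x +i* v x)%C.
Proof.
move=> /lderivP hu /lderivP hv; split.
  by move=> x; split; [have [] := hu x|have [] := hv x].
apply/funext => x; rewrite /cpartial.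
by have [_ ->] := hu x; have [_ ->] := hv x.
Qed.

Lemma cderivable_lderiv phi i : (forall x, cderivable phi x i) ->
  lderiv (e_ i) (fun x => complex.Re (phi x)) (fun x => complex.Re (cpartial i phi x)) /\
  lderiv (e_ i) (fun x => complex.Im (phi x)) (fun x => complex.Im (cpartial i phi x)).
Proof.
move=> h; split; apply/lderivP => x; have [h1 h2] := h x.
  exact: DeriveDef h1 erefl.
exact: DeriveDef h2 erefl.
Qed.

Lemma schwartz_norm_ub N phi (a : seq 'I_n) x : schwartz phi -> (size a <= N)%N ->
  sqn x ^+ N * cmod (cpartials a phi x) <= schwartz_norm N phi.
Proof.
move=> [_ hb] aN; apply: sup_upper_bound; last by exists a, x.
by split; [exists (sqn x ^+ N * cmod (cpartials a phi x)), a, x|exact: hb].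
Qed.

Lemma schwartz_lderiv phi i : schwartz phi ->
  lderiv (e_ i) (fun x => complex.Re (phi x)) (fun x => complex.Re (cpartial i phi x)) /\
  lderiv (e_ i) (fun x => complex.Im (phi x)) (fun x => complex.Im (cpartial i phi x)).
Proof. by move=> [h _]; apply: cderivable_lderiv => x; exact: (h [::]). Qed.

(** Differentiating first in direction [i] appends [i] at the end of the index list, so a bound of
    order [N] for the derivative costs one of order [N + 1] for [phi]. *)
Lemma schwartz_cpartial phi i : schwartz phi -> schwartz (cpartial i phi).
Proof.
move=> hphi; have [h1 h2] := hphi; split.
  by move=> a x j; have := h1 (rcons a i) x j; rewrite /cpartials foldr_rcons.
move=> N; exists (schwartz_norm N.+1 phi) => r [a [x [aN ->]]].
have := @schwartz_norm_ub N.+1 phi (rcons a i) x hphi.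
rewrite size_rcons ltnS => /(_ aN); rewrite /cpartials foldr_rcons.
apply: le_trans; rewrite ler_wpM2r ?cmod_ge0//.
by rewrite ler_weXn2l// sqn_ge1.
Qed.

Lemma schwartz_decay phi N x : schwartz phi ->
  cmod (phi x) <= schwartz_norm N phi * sqn x ^- N.
Proof.
move=> hphi; rewrite ler_pdivlMr ?exprn_gt0 ?sqn_gt0// mulrC.
exact: (@schwartz_norm_ub N phi [::]).
Qed.

(** The seminorm of order 1 bounds all first partial derivatives, which makes both components
    Lipschitz. *)
Lemma schwartz_cmeasurable phi : schwartz phi -> cmeasurable phi.
Proof.
move=> hphi; pose B := schwartz_norm 1 phi.
have HB (f : V -> R) (df : 'I_n -> V -> R) :
    (forall i, lderiv (e_ i) f (df i)) -> (forall i x, `|df i x| <= B) ->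
    measurable_fun setT f.
  move=> hf hB; apply: (@lipschitz_measurable _ _ f B) => x y.
  apply: lipschitz_coords => {}x i t.
  have := @derive_bounded_lipschitz R (fun r => f (x + r *: e_ i)) _ B
    (lderiv_line (hf i) x) (fun r => hB i _) 0 t.
  by rewrite scale0r addr0 subr0.
have pB i x : cmod (cpartial i phi x) <= B.
  have := @schwartz_norm_ub 1 phi [:: i] x hphi (leqnn _).
  apply: le_trans; rewrite expr1 -[leLHS]mul1r ler_wpM2r ?cmod_ge0//.
  exact: sqn_ge1.
split.
  apply: (HB _ (fun i x => complex.Re (cpartial i phi x))) => i.
    by have [] := schwartz_lderiv i hphi.
  by move=> x; rewrite (le_trans (normr_Re_le _)).
apply: (HB _ (fun i x => complex.Im (cpartial i phi x))) => i.
  by have [] := schwartz_lderiv i hphi.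
by move=> x; rewrite (le_trans (normr_Im_le _)).
Qed.

Lemma integrable_decay (C : R) : mu.-integrable setT
  (EFin \o (fun x => C * sqn x ^- n)).
Proof. by apply: integrable_scale; exact: integrable_sqnV. Qed.

Lemma schwartz_cintegrable phi : schwartz phi -> cintegrable phi.
Proof.
move=> hphi; apply: cintegrable_le (integrable_decay (schwartz_norm n phi)) _.
  exact: schwartz_cmeasurable.
by move=> x; exact: schwartz_decay.
Qed.

(** Translations of length at most 1 change the weight by a bounded factor; this gives one
    dominating function for all small translates. *)
Lemma sqn_shift x y : dotv y y <= 1 -> sqn x <= 3 * sqn (x + y).
Proof.
move=> y1; rewrite /sqn.
have H : dotv x x <= 2 * dotv (x + y) (x + y) + 2 * dotv y y.
  rewrite /dotv !mulr_sumr -big_split/=; apply: ler_sum => i _; rewrite !mxE.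
  rewrite -subr_ge0 (_ : _ - _ = (x ord0 i + 2 * y ord0 i) ^+ 2) ?sqr_ge0//; ring.
have := dotv_ge0 (x + y); lra.
Qed.

Lemma dotv_delta i (t : R) : dotv (t *: e_ i) (t *: e_ i) = t ^+ 2.
Proof.
rewrite /dotv (bigD1 i)//= big1 ?addr0 => [|j /negbTE ji].
  by rewrite !mxE !eqxx mulr1 expr2.
by rewrite !mxE eqxx /= ji mulr0 mul0r.
Qed.

(** The integral of [u (x + r e_i)] does not depend on [r], by translation invariance;
    differentiating it under the integral sign at [r = 0] gives the claim, with no boundary
    terms. *)
Lemma Rintegral_lderiv0 i (u du : V -> R) (C : R) :
  mu.-integrable setT (EFin \o u) -> lderiv (e_ i) u du ->
  (forall x, `|du x| <= C * sqn x ^- n) -> \int[mu]_x du x = 0.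
Proof.
move=> intu hu hC.
have C0 : 0 <= C.
  have := le_trans (normr_ge0 _) (hC 0); rewrite pmulr_lge0//.
  by rewrite invr_gt0 exprn_gt0// sqn_gt0.
pose f (r : R) (x : V) := u (x + r *: e_ i).
have I0 : `](-1 : R), 1[%classic 0 by rewrite /= in_itv/= ltrN10 ltr01.
have intf r : mu.-integrable setT (EFin \o f r).
  have := integrable_rV_affine (r *: e_ i) (oner_neq0 R) intu.
  by under eq_fun do rewrite scale1r.
have constF r : \int[mu]_x f r x = \int[mu]_x u x.
  have := Rintegral_rV_affine (r *: e_ i) (oner_neq0 R) intu.
  rewrite normr1 invr1 expr1n mul1r => <-.
  by apply: eq_Rintegral => x _; rewrite scale1r.
have d1f r x : partial1of2 f r x = du (x + r *: e_ i).
  rewrite partial1of2E; have [_ e] := lderiv_line hu x r; exact: e.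
have sV0 x : 0 <= sqn x ^- n by rewrite invr_ge0 exprn_ge0// ltW// sqn_gt0.
(* The factor [3 ^+ n] is the cost of [sqn_shift], as [|r| < 1]. *)
have G0 (x : V) : 0 <= (C * 3 ^+ n) * sqn x ^- n by rewrite !mulr_ge0// exprn_ge0.
have df1 (r : R) (x : V) : `](-1 : R), 1[%classic r -> setT x -> derivable (f ^~ x) r 1.
  by move=> _ _; have [] := lderiv_line hu x r.
have Gub (r : R) (x : V) : `](-1 : R), 1[%classic r -> setT x ->
    `|partial1of2 f r x| <= (C * 3 ^+ n) * sqn x ^- n.
  rewrite /= in_itv/= => /andP[r1 r2] _; rewrite d1f.
  rewrite (le_trans (hC _))// -mulrA ler_wpM2l//.
  rewrite -exprVn -[sqn x ^- n]exprVn -exprMn lerXn2r ?nnegrE//.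
  - by rewrite invr_ge0 ltW// sqn_gt0.
  - by rewrite mulr_ge0// invr_ge0 ltW// sqn_gt0.
  rewrite ler_pdivlMr ?sqn_gt0// mulrC ler_pdivrMr ?sqn_gt0// sqn_shift//.
  by rewrite dotv_delta; nra.
have := @differentiation_under_integral R _ V mu f setT measurableT 0 (-1) 1 I0
  (fun r _ => intf r) df1 _ G0 (integrable_decay _) Gub.
rewrite (_ : (fun x' : R => _) = (fun=> \int[mu]_x u x)); last first.
  by apply/funext => r; rewrite constF.
rewrite derive1_cst => h.
rewrite [RHS]h; apply: eq_Rintegral => x _.
by rewrite d1f scale0r addr0.
Qed.

(* Integration by parts: the integral of the derivative of x |-> cis(-x.xi) phi x
   vanishes. *)
Lemma fourier_cpartial phi i xi : schwartz phi ->
  fourier (cpartial i phi) xi = (0 +i* xi ord0 i)%C * fourier phi xi.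
Proof.
move=> hphi.
have hpi := schwartz_cpartial i hphi.
have [d1 d2] := schwartz_lderiv i hphi.
have dl : lderiv (e_ i) (fun x => dotv x xi) (fun=> xi ord0 i).
  have -> : xi ord0 i = dotv (e_ i) xi; last exact: lderiv_dotv.
  rewrite /dotv (bigD1 i)//= big1 ?addr0 => [|j /negbTE ji].
    by rewrite !mxE !eqxx mul1r.
  by rewrite !mxE eqxx /= ji mul0r.
have dc : lderiv (e_ i) (fun x => cos (dotv x xi))
    (fun x => - sin (dotv x xi) * xi ord0 i).
  by apply: lderiv_comp dl _ => t; exact: is_derive_cos.
have ds : lderiv (e_ i) (fun x => sin (dotv x xi))
    (fun x => cos (dotv x xi) * xi ord0 i).
  by apply: lderiv_comp dl _ => t; exact: is_derive_sin.
have mcis : cmeasurable (fun x : V => cis (- dotv x xi)).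
  apply: cmeasurable_cis; apply: measurableT_comp => //; exact: measurable_dotv.
have icis psi : cintegrable psi -> cintegrable (fun x => cis (- dotv x xi) * psi x).
  move=> ipsi; apply: (@cintegrableM_bounded _ _ _ _ 1) => //.
  by move=> x; rewrite cmod_cis.
have iphi := schwartz_cintegrable hphi; have ipi := schwartz_cintegrable hpi.
have key : cint (fun x => cis (- dotv x xi) * cpartial i phi x +
    (0 +i* - xi ord0 i)%C * (cis (- dotv x xi) * phi x)) = 0.
  pose C := schwartz_norm n (cpartial i phi) + `|xi ord0 i| * schwartz_norm n phi.
  have bd x : cmod (cis (- dotv x xi) * cpartial i phi x +
    (0 +i* - xi ord0 i)%C * (cis (- dotv x xi) * phi x)) <= C * sqn x ^- n.
    rewrite (le_trans (cmodD _ _))// !cmodM !cmod_cis !mul1r.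
    have -> : cmod (0 +i* - xi ord0 i)%C = `|xi ord0 i|.
      by rewrite cmodE/= expr0n add0r sqrtr_sqr normrN.
    rewrite mulrDl lerD//; first exact: schwartz_decay.
    by rewrite -mulrA ler_wpM2l//; exact: schwartz_decay.
  have [i1 i2] := icis _ iphi.
  apply: complex_ext => /=.
    apply: (Rintegral_lderiv0 i1) => [|x]; last exact: le_trans (normr_Re_le _) (bd x).
    have := lderivD (lderivM dc d1) (lderivM ds d2).
    by congr (lderiv _ _ _); apply/funext => x;
      rewrite ?Re_add !Re_mul/= ?Re_mul ?Im_mul/= cosN sinN; ring.
  apply: (Rintegral_lderiv0 i2) => [|x]; last exact: le_trans (normr_Im_le _) (bd x).
  have := lderivD (lderivM dc d2) (lderivZ (-1) (lderivM ds d1)).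
  by congr (lderiv _ _ _); apply/funext => x;
    rewrite ?Im_add !Im_mul/= ?Re_mul ?Im_mul/= cosN sinN; ring.
move: key; rewrite cintD; last 2 first.
- exact: icis.
- by apply: cintegrableZ; exact: icis.
rewrite cintZ; last exact: icis.
move=> /eqP; rewrite addr_eq0 => /eqP; rewrite /fourier => ->.
rewrite -mulNr; congr (_ * _).
by apply: complex_ext => /=; rewrite ?oppr0 ?opprK.
Qed.

End schwartz_theory.

(** * Fourier transform *)

Section fourier_theory.
Context {R : realType} {n : nat}.
Local Notation V := 'rV[R]_n.
Local Notation mu := (@lebesgue_rV R n).
Local Notation e_ i := (delta_mx ord0 i : V).
Implicit Types (f g phi psi : V -> R[i]) (x xi : V).

Lemma dotvC (x y : V) : dotv x y = dotv y x.
Proof. by apply: eq_bigr => i _; rewrite mulrC. Qed.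

Lemma cmeasurable_character xi : cmeasurable (fun x : V => cis (- dotv x xi)).
Proof.
apply: cmeasurable_cis; apply: measurableT_comp => //; exact: measurable_dotv.
Qed.

Lemma cintegrable_fourier f xi : cintegrable f ->
  cintegrable (fun x => cis (- dotv x xi) * f x).
Proof.
move=> intf; apply: (@cintegrableM_bounded _ _ _ _ 1) => //.
  exact: cmeasurable_character.
by move=> x; rewrite cmod_cis.
Qed.

Lemma fourier_bounded f xi : cintegrable f ->
  cmod (fourier f xi) <= 2 * \int[mu]_x cmod (f x).
Proof.
move=> intf; rewrite (le_trans (cmod_cint_le (cintegrable_fourier xi intf)))//.
by under eq_Rintegral do rewrite cmodM cmod_cis mul1r.
Qed.

Lemma fourierZ (c : R[i]) f xi : cintegrable f ->
  fourier (fun x => c * f x) xi = c * fourier f xi.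
Proof.
move=> intf; rewrite /fourier -cintZ; last exact: cintegrable_fourier.
by congr cint; apply/funext => x; ring.
Qed.

(** Multiplying the transform by [xi_i^2] amounts, up to sign, to differentiating [phi] twice in
    direction [i]. Each factor [1 + |xi|^2] is thus traded for [phi] itself and its pure second
    derivatives, so the induction must range over all Schwartz functions. *)
Lemma fourier_decay phi N : schwartz phi ->
  exists C : R, forall xi, sqn xi ^+ N * cmod (fourier phi xi) <= C.
Proof.
elim: N phi => [|N ih] phi hphi.
  exists (2 * \int[mu]_x cmod (phi x)) => xi; rewrite expr0 mul1r.
  by apply: fourier_bounded; exact: schwartz_cintegrable.
have [C0 hC0] := ih phi hphi.
have hpp i : schwartz (cpartial i (cpartial i phi)).
  by do 2 apply: schwartz_cpartial.
have /choice[C hC] : forall i, exists C : R, forall xi,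
    sqn xi ^+ N * cmod (fourier (cpartial i (cpartial i phi)) xi) <= C.
  by move=> i; exact: ih.
exists (C0 + \sum_i C i) => xi.
rewrite exprSr -mulrA {2}/sqn mulrDl mul1r mulrDr lerD//.
rewrite /dotv mulr_suml mulr_sumr; apply: ler_sum => i _.
rewrite (le_trans _ (hC i xi))// ler_wpM2l ?exprn_ge0 ?(ltW (sqn_gt0 _))//.
rewrite fourier_cpartial; last exact: schwartz_cpartial.
rewrite fourier_cpartial// !cmodM.
have -> : cmod (0 +i* xi ord0 i)%C = `|xi ord0 i|.
  by rewrite cmodE/= expr0n add0r sqrtr_sqr.
by rewrite [leRHS]mulrA ler_wpM2r ?cmod_ge0// -normrM ler_norm.
Qed.

(** The real part of the Fourier integrand has this shape with [(p, q) = (Re f, Im f)], and the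
    imaginary part with [(p, q) = (Im f, - Re f)]; one real lemma covers both. *)
Lemma measurable_fourier_kernel (p q : V -> R) :
  measurable_fun setT p -> measurable_fun setT q ->
  measurable_fun setT (fun z : V * V => cos (dotv z.2 z.1) * p z.2 + sin (dotv z.2 z.1) * q z.2).
Proof.
move=> mp mq.
have md : measurable_fun setT (fun z : V * V => dotv z.2 z.1).
  by apply: measurable_dotv.
apply: measurable_funD; apply: measurable_funM.
- apply: (measurableT_comp (f := cos)) md.
  by apply: continuous_measurable_fun; exact: continuous_cos.
- exact: (measurableT_comp mp).
- apply: (measurableT_comp (f := sin)) md.
  by apply: continuous_measurable_fun; exact: continuous_sin.
- exact: (measurableT_comp mq).
Qed.

Lemma Re_fourier_kernel (a : R) (z : R[i]) :
  complex.Re (cis (- a) * z) = cos a * complex.Re z + sin a * complex.Im z.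
Proof. by rewrite Re_mul/= cosN sinN; ring. Qed.

Lemma Im_fourier_kernel (a : R) (z : R[i]) :
  complex.Im (cis (- a) * z) = cos a * complex.Im z + sin a * (- complex.Re z).
Proof. by rewrite Im_mul/= cosN sinN; ring. Qed.

Lemma cmeasurable_fourier f : cmeasurable f -> cmeasurable (fourier f).
Proof.
move=> [m1 m2]; split.
  have := measurable_Rintegral (measurable_fourier_kernel m1 m2).
  congr (measurable_fun _ _); apply/funext => xi; apply: eq_Rintegral => x _.
  by rewrite Re_fourier_kernel.
have m1N : measurable_fun setT (fun x => - complex.Re (f x)) by exact: measurable_funN.
have := measurable_Rintegral (measurable_fourier_kernel m2 m1N).
congr (measurable_fun _ _); apply/funext => xi; apply: eq_Rintegral => x _.
by rewrite Im_fourier_kernel.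
Qed.

Lemma fourier_ccvg f (u : nat -> V) xi : cintegrable f ->
  (forall x, (fun k => dotv x (u k)) @ \oo --> dotv x xi) ->
  ccvg (fun k => fourier f (u k)) (fourier f xi).
Proof.
move=> intf ux; apply: dominated_cint.
- by move=> k; apply: cintegrable_meas; exact: cintegrable_fourier.
- by apply: cintegrable_meas; exact: cintegrable_fourier.
- exact: integrable_cmod intf.
- move=> x; apply: ccvgM; last exact: ccvg_cst.
  by apply: ccvg_cis; apply: cvgN; exact: ux.
- by move=> k x; rewrite cmodM cmod_cis mul1r.
Qed.

(** Fubini for the kernel [g x * cis (- x.y) * f y], which is symmetric in the character and
    dominated by [|g x| |f y|]. *)
Lemma fourier_multiplication f g : cintegrable f -> cintegrable g ->
  cint (fun x => g x * fourier f x) = cint (fun x => f x * fourier g x).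
Proof.
move=> intf intg.
pose k x y := g x * (cis (- dotv y x) * f y).
have E1 x : g x * fourier f x = cint (k x).
  by rewrite /k cintZ//; exact: cintegrable_fourier.
have E2 y : f y * fourier g y = cint (k ^~ y).
  rewrite /fourier -cintZ; last exact: cintegrable_fourier.
  by congr cint; apply/funext => x; rewrite /k dotvC; ring.
under [in LHS]eq_fun do rewrite E1.
under [in RHS]eq_fun do rewrite E2.
have [f1 f2] := cintegrable_meas intf; have [g1 g2] := cintegrable_meas intg.
have m1 := measurable_fourier_kernel f1 f2.
have m2 := measurable_fourier_kernel f2 (measurable_funN f1).
have g1' : measurable_fun setT (fun z : V * V => complex.Re (g z.1)).
  exact: (measurableT_comp g1).
have g2' : measurable_fun setT (fun z : V * V => complex.Im (g z.1)).
  exact: (measurableT_comp g2).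
apply: (@cint_fubini _ _ k (fun x => cmod (g x)) (fun y => cmod (f y))).
- under eq_fun do rewrite /k Re_mul Re_fourier_kernel Im_fourier_kernel.
  by apply: measurable_funB; apply: measurable_funM.
- under eq_fun do rewrite /k Im_mul Re_fourier_kernel Im_fourier_kernel.
  by apply: measurable_funD; apply: measurable_funM.
- exact: integrable_cmod.
- exact: integrable_cmod.
- by move=> x y; rewrite /k !cmodM cmod_cis mul1r.
Qed.

(** The differentiated integrand is dominated by [|x_i q| + |x_i p|] whatever the parameter, so the
    derivative passes under the integral. The functions [p] and [q] are kept free to serve both
    components of a transform. *)
Lemma lderiv_trig_integral i (p q : V -> R) :
  mu.-integrable setT (EFin \o p) -> mu.-integrable setT (EFin \o q) ->
  mu.-integrable setT (EFin \o (fun x => x ord0 i * p x)) ->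
  mu.-integrable setT (EFin \o (fun x => x ord0 i * q x)) ->
  lderiv (e_ i)
    (fun xi => \int[mu]_x (cos (dotv x xi) * p x + sin (dotv x xi) * q x))
    (fun xi => \int[mu]_x (cos (dotv x xi) * (x ord0 i * q x) +
      sin (dotv x xi) * - (x ord0 i * p x))).
Proof.
move=> ip iq ixp ixq xi.
have I0 : `](-1 : R), 1[%classic 0 by rewrite /= in_itv/= ltrN10 ltr01.
have intf (p' q' : V -> R) (eta : V) : mu.-integrable setT (EFin \o p') ->
    mu.-integrable setT (EFin \o q') -> mu.-integrable setT
    (EFin \o (fun x => cos (dotv x eta) * p' x + sin (dotv x eta) * q' x)).
  move=> ip' iq'.
  have mE (u : V -> R) : mu.-integrable setT (EFin \o u) -> measurable_fun setT u.
    by move=> iu; apply/measurable_EFinP; exact: (measurable_int mu).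
  have := integrableD measurableT (integrable_norm ip') (integrable_norm iq').
  apply: le_integrable => //.
    apply/measurable_EFinP.
    have := measurable_fourier_kernel (mE _ ip') (mE _ iq').
    by move=> /measurableT_comp /(_ (pair1_measurable eta)).
  move=> x _ /=; rewrite lee_fin (le_trans (ler_normD _ _))// [leRHS]ger0_norm ?addr_ge0//.
  by rewrite lerD// normrM -[leRHS]mul1r ler_wpM2r// ?cos_max ?sin_max.
pose F (r : R) (x : V) := cos (dotv x (xi + r *: e_ i)) * p x +
    sin (dotv x (xi + r *: e_ i)) * q x.
have dot x r : dotv x (xi + r *: e_ i) = dotv x xi + r * x ord0 i.
  rewrite /dotv.
  under eq_bigr do rewrite !mxE mulrDr.
  rewrite big_split/=; congr (_ + _).
  rewrite (bigD1 i)//= big1 ?addr0 => [|j /negbTE ji].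
    by rewrite !eqxx mulr1 mulrC.
  by rewrite ji !mulr0.
have dF (r : R) x : is_derive r 1 (F ^~ x)
    (cos (dotv x (xi + r *: e_ i)) * (x ord0 i * q x) +
     sin (dotv x (xi + r *: e_ i)) * - (x ord0 i * p x)).
  rewrite (_ : F ^~ x = (fun r : R => cos (dotv x xi + r * x ord0 i) * p x +
    sin (dotv x xi + r * x ord0 i) * q x)); last first.
    by apply/funext => r'; rewrite /F dot.
  rewrite dot.
  have dl : is_derive r 1 (fun r : R => dotv x xi + r * x ord0 i) (x ord0 i).
    by apply: is_derive_eq; rewrite /GRing.scale/=; ring.
  have dcos := @is_derive1_comp _ cos _ r _ _ (is_derive_cos _) dl.
  have dsin := @is_derive1_comp _ sin _ r _ _ (is_derive_sin _) dl.
  rewrite /comp in dcos dsin.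
  by apply: is_derive_eq; rewrite /GRing.scale/=; ring.
have d1 r x : partial1of2 F r x = cos (dotv x (xi + r *: e_ i)) * (x ord0 i * q x) +
     sin (dotv x (xi + r *: e_ i)) * - (x ord0 i * p x).
  by rewrite partial1of2E; have [_ e] := dF r x; exact: e.
pose G x := `|x ord0 i * q x| + `|x ord0 i * p x|.
have G0 x : 0 <= G x by rewrite addr_ge0.
have iG : mu.-integrable setT (EFin \o G).
  by have := integrableD measurableT (integrable_norm ixq) (integrable_norm ixp).
have bG (r : R) (x : V) : `](-1 : R), 1[%classic r -> setT x -> `|partial1of2 F r x| <= G x.
  move=> _ _; rewrite d1 (le_trans (ler_normD _ _))// lerD//.
    by rewrite normrM -[leRHS]mul1r ler_wpM2r// cos_max.
  by rewrite normrM normrN -[leRHS]mul1r ler_wpM2r// sin_max.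
have dF' (r : R) (x : V) : `](-1 : R), 1[%classic r -> setT x -> derivable (F ^~ x) r 1.
  by move=> _ _; have [] := dF r x.
have iF r : mu.-integrable setT (EFin \o F r) by exact: intf.
apply: DeriveDef.
  exact: (@derivable_under_integral R _ V mu F setT measurableT 0 (-1) 1 I0
  (fun r _ => iF r) dF' _ G0 iG bG).
rewrite -derive1E (@differentiation_under_integral R _ V mu F setT measurableT 0 (-1) 1 I0
  (fun r _ => iF r) dF' _ G0 iG bG).
by apply: eq_Rintegral => x _; rewrite d1 scale0r addr0.
Qed.

Lemma lderiv_fourier i f : cintegrable f ->
  cintegrable (fun x => (0 +i* - x ord0 i)%C * f x) ->
  lderiv (e_ i) (fun xi => complex.Re (fourier f xi))
    (fun xi => complex.Re (fourier (fun x => (0 +i* - x ord0 i)%C * f x) xi)) /\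
  lderiv (e_ i) (fun xi => complex.Im (fourier f xi))
    (fun xi => complex.Im (fourier (fun x => (0 +i* - x ord0 i)%C * f x) xi)).
Proof.
move=> [i1 i2] [j1 j2].
have k1 : mu.-integrable setT (EFin \o (fun x => x ord0 i * complex.Re (f x))).
  have := integrableN j2; congr (_.-integrable _ _); apply/funext => x /=.
  by rewrite Im_mul/=; congr EFin; ring.
have k2 : mu.-integrable setT (EFin \o (fun x => x ord0 i * complex.Im (f x))).
  move: j1; congr (_.-integrable _ _); apply/funext => x /=.
  by rewrite Re_mul/=; congr EFin; ring.
split.
  have := lderiv_trig_integral i1 i2 k1 k2.
  congr (lderiv _ _ _); apply/funext => xi; apply: eq_Rintegral => x _.
    by rewrite Re_fourier_kernel.
  by rewrite Re_fourier_kernel Re_mul Im_mul/=; ring.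
have i1N := integrableN i1.
have k1N : mu.-integrable setT (EFin \o (fun x => x ord0 i * - complex.Re (f x))).
  have := integrableN k1; congr (_.-integrable _ _); apply/funext => x /=.
  by congr EFin; ring.
have := @lderiv_trig_integral i _ (fun x => - complex.Re (f x)) i2 i1N k2 k1N.
congr (lderiv _ _ _); apply/funext => xi; apply: eq_Rintegral => x _.
  by rewrite Im_fourier_kernel.
by rewrite Im_fourier_kernel Re_mul Im_mul/=; ring.
Qed.

End fourier_theory.

(** * Gaussians *)

Section gaussian.
Context {R : realType} {n : nat}.
Local Notation V := 'rV[R]_n.
Local Notation mu := (@lebesgue_rV R n).
Local Notation e_ i := (delta_mx ord0 i : V).
Implicit Types (phi : V -> R[i]) (x xi : V) (a b : R).

(** This is [exp(- w |x|^2)] with [w = a + i b], split into modulus and phase. *)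
Definition gaussian a b x : R[i] :=
  (expR (- (a * dotv x x)))%:C%C * cis (- (b * dotv x x)).

Lemma Re_gaussian a b x : complex.Re (gaussian a b x) =
  expR (- (a * dotv x x)) * cos (b * dotv x x).
Proof. by rewrite /gaussian Re_mul/= cosN mul0r subr0. Qed.

Lemma Im_gaussian a b x : complex.Im (gaussian a b x) =
  - (expR (- (a * dotv x x)) * sin (b * dotv x x)).
Proof. by rewrite /gaussian Im_mul/= sinN mul0r addr0 mulrN. Qed.

Lemma cmod_gaussian a b x : cmod (gaussian a b x) = expR (- (a * dotv x x)).
Proof. by rewrite cmodM cmod_cis mulr1 cmod_real gtr0_norm// expR_gt0. Qed.

Lemma gaussianM a b c d x :
  gaussian a b x * gaussian c d x = gaussian (a + c) (b + d) x.
Proof.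
rewrite /gaussian mulrACA -rmorphM/= -expRD -cisD.
by congr ((expR _)%:C%C * cis _); ring.
Qed.

Lemma gaussian00 x : gaussian 0 0 x = 1.
Proof. by rewrite /gaussian !mul0r oppr0 expR0 cis0 mulr1. Qed.

Lemma gaussian_at0 a b : gaussian a b 0 = 1.
Proof.
have -> : gaussian a b 0 = gaussian 0 0 0.
  have z : dotv (0 : V) 0 = 0 by rewrite /dotv big1// => i _; rewrite mxE mul0r.
  by rewrite /gaussian z !mulr0.
exact: gaussian00.
Qed.

Lemma gaussian_scale a b (k : R) x :
  gaussian a b (k *: x) = gaussian (k ^+ 2 * a) (k ^+ 2 * b) x.
Proof.
have -> : gaussian a b (k *: x) =
    (expR (- (a * (k ^+ 2 * dotv x x))))%:C%C * cis (- (b * (k ^+ 2 * dotv x x))).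
  have -> // : k ^+ 2 * dotv x x = dotv (k *: x) (k *: x).
  by rewrite /dotv mulr_sumr; apply: eq_bigr => i _; rewrite !mxE; ring.
by rewrite /gaussian; congr ((expR _)%:C%C * cis _); ring.
Qed.

Lemma dotv_e x i : dotv x (e_ i) = x ord0 i.
Proof.
rewrite /dotv (bigD1 i)//= big1 ?addr0 => [|j /negbTE ji].
  by rewrite !mxE !eqxx mulr1.
by rewrite !mxE eqxx /= ji mulr0.
Qed.

Lemma lderiv_expcos a b i : lderiv (e_ i)
  (fun x => expR (- (a * dotv x x)) * cos (b * dotv x x))
  (fun x => - (2 * a) * (x ord0 i * (expR (- (a * dotv x x)) * cos (b * dotv x x))) +
     - (2 * b) * (x ord0 i * (expR (- (a * dotv x x)) * sin (b * dotv x x)))).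
Proof.
have dE : lderiv (e_ i) (fun x => expR (- (a * dotv x x)))
    (fun x => expR (- (a * dotv x x)) * (- a * (2 * dotv x (e_ i)))).
  apply: (lderiv_comp (h := expR) (dh := expR)).
  have := lderivZ (- a) (lderiv_sq (e_ i)).
  by congr (lderiv _ _ _); apply/funext => x; rewrite mulNr.
have dc : lderiv (e_ i) (fun x => cos (b * dotv x x))
    (fun x => - sin (b * dotv x x) * (b * (2 * dotv x (e_ i)))).
  apply: (lderiv_comp (h := cos) (dh := fun t => - sin t)).
  exact: lderivZ (lderiv_sq _).
have := lderivM dE dc.
by congr (lderiv _ _ _); apply/funext => x; rewrite dotv_e; ring.
Qed.

Lemma lderiv_expsin a b i : lderiv (e_ i)
  (fun x => expR (- (a * dotv x x)) * sin (b * dotv x x))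
  (fun x => - (2 * a) * (x ord0 i * (expR (- (a * dotv x x)) * sin (b * dotv x x))) +
     (2 * b) * (x ord0 i * (expR (- (a * dotv x x)) * cos (b * dotv x x)))).
Proof.
have dE : lderiv (e_ i) (fun x => expR (- (a * dotv x x)))
    (fun x => expR (- (a * dotv x x)) * (- a * (2 * dotv x (e_ i)))).
  apply: (lderiv_comp (h := expR) (dh := expR)).
  have := lderivZ (- a) (lderiv_sq (e_ i)).
  by congr (lderiv _ _ _); apply/funext => x; rewrite mulNr.
have dc : lderiv (e_ i) (fun x => sin (b * dotv x x))
    (fun x => cos (b * dotv x x) * (b * (2 * dotv x (e_ i)))).
  apply: (lderiv_comp (h := sin) (dh := cos)).
  exact: lderivZ (lderiv_sq _).
have := lderivM dE dc.
by congr (lderiv _ _ _); apply/funext => x; rewrite dotv_e; ring.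
Qed.

(* Real and imaginary parts of polynomial multiples of a gaussian: a class
   closed under differentiation. *)
Inductive gauss_class a b : (V -> R) -> Prop :=
| gauss_cos : gauss_class a b (fun x => expR (- (a * dotv x x)) * cos (b * dotv x x))
| gauss_sin : gauss_class a b (fun x => expR (- (a * dotv x x)) * sin (b * dotv x x))
| gauss_coord i f : gauss_class a b f -> gauss_class a b (fun x => x ord0 i * f x)
| gauss_scale c f : gauss_class a b f -> gauss_class a b (fun x => c * f x)
| gauss_add f g : gauss_class a b f -> gauss_class a b g ->
    gauss_class a b (fun x => f x + g x).

Lemma lderiv_coord i j : lderiv (e_ i) (fun x => x ord0 j) (fun=> (j == i)%:R).
Proof.
have := lderiv_dotv (e_ i) (e_ j).
congr (lderiv _ _ _); apply/funext => x; first by rewrite dotv_e.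
by rewrite dotv_e !mxE eqxx.
Qed.

Lemma gauss_class_lderiv a b f i : gauss_class a b f ->
  exists g, gauss_class a b g /\ lderiv (e_ i) f g.
Proof.
elim=> {f} [||j f cf [g [cg dg]]|c f cf [g [cg dg]]|f1 f2 _ [g1 [c1 d1]] _ [g2 [c2 d2]]].
- eexists; split; last exact: lderiv_expcos.
  by apply: gauss_add; apply: gauss_scale; apply: gauss_coord; constructor.
- eexists; split; last exact: lderiv_expsin.
  by apply: gauss_add; apply: gauss_scale; apply: gauss_coord; constructor.
- exists (fun x => x ord0 j * g x + (j == i)%:R * f x); split.
    by apply: gauss_add; [exact: gauss_coord|exact: gauss_scale].
  have := lderivM (lderiv_coord i j) dg.
  by congr (lderiv _ _ _); apply/funext => x; rewrite [f x * _]mulrC.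
- by exists (fun x => c * g x); split; [exact: gauss_scale|exact: lderivZ].
- by exists (fun x => g1 x + g2 x); split; [exact: gauss_add|exact: lderivD].
Qed.

(** With [c <= 1] and [c <= a / N], one has [c (1 + q) <= 1 + (a / N) q <= exp(a q / N)]; raising to
    the power [N] gives the constant [c^-N]. *)
Lemma expR_decay a N : 0 < a ->
  exists C : R, forall q, 0 <= q -> (1 + q) ^+ N * expR (- (a * q)) <= C.
Proof.
move=> a0; case: N => [|N].
  exists 1 => q q0; rewrite expr0 mul1r -expR0 ler_expR oppr_le0.
  by rewrite mulr_ge0// ltW.
pose c := Num.min 1 (a / N.+1%:R).
have c0 : 0 < c by rewrite lt_min ltr01 divr_gt0// ltr0n.
exists (c ^- N.+1) => q q0.
rewrite expRN ler_pdivrMr ?expR_gt0//.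
rewrite -ler_pdivrMl ?invr_gt0 ?exprn_gt0// invrK -exprMn.
have -> : a * q = N.+1%:R * (a / N.+1%:R * q) by rewrite mulrA [_ * (a / _)]mulrC divfK ?pnatr_eq0.
rewrite expRM_natl lerXn2r ?nnegrE ?expR_ge0 ?mulr_ge0 ?(ltW c0) ?addr_ge0//.
apply: le_trans (expR_ge1Dx _); rewrite mulrDr mulr1 lerD ?ler_wpM2r//.
  by rewrite /c ge_min lexx.
by rewrite /c ge_min lexx orbT.
Qed.

Lemma gauss_class_bounded a b f : 0 < a -> gauss_class a b f ->
  forall N, exists C : R, forall x, sqn x ^+ N * `|f x| <= C.
Proof.
move=> a0.
have s0 N x : 0 <= sqn x ^+ N by rewrite exprn_ge0// ltW// sqn_gt0.
elim=> {f} [||j f _ ih|c f _ ih|f1 f2 _ ih1 _ ih2] N.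
- have [C hC] := expR_decay N a0; exists C => x.
  rewrite (le_trans _ (hC _ (dotv_ge0 x)))// ler_wpM2l// normrM -[leRHS]mulr1.
  by rewrite ler_pM// ?cos_max// gtr0_norm ?expR_gt0.
- have [C hC] := expR_decay N a0; exists C => x.
  rewrite (le_trans _ (hC _ (dotv_ge0 x)))// ler_wpM2l// normrM -[leRHS]mulr1.
  by rewrite ler_pM// ?sin_max// gtr0_norm ?expR_gt0.
(* The coordinate is absorbed by one more power of the weight: [|x_j| <= 1 + x_j^2 <= sqn x]. *)
- have [C hC] := ih N.+1; exists C => x.
  rewrite (le_trans _ (hC x))// exprSr normrM mulrA ler_wpM2r// ler_wpM2l//.
  rewrite (le_trans _ (oneDsqr_le_sqn x j))// /oneDsqr.
  have := real_normK (num_real (x ord0 j)); set t := `|_| => <-.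
  by rewrite -subr_ge0; have := sqr_ge0 (t - 1/2); nra.
- have [C hC] := ih N; exists (`|c| * C) => x.
  by rewrite normrM mulrCA ler_wpM2l.
- have [C1 h1] := ih1 N; have [C2 h2] := ih2 N; exists (C1 + C2) => x.
  rewrite (le_trans (ler_wpM2l (s0 _ _) (ler_normD _ _)))//.
  by rewrite mulrDr lerD.
Qed.

Definition cgauss_class a b phi : Prop :=
  gauss_class a b (fun x => complex.Re (phi x)) /\
  gauss_class a b (fun x => complex.Im (phi x)).

Lemma cgauss_class_cpartial a b phi i : cgauss_class a b phi ->
  (forall x, cderivable phi x i) /\ cgauss_class a b (cpartial i phi).
Proof.
move=> [c1 c2].
have [g1 [h1 d1]] := gauss_class_lderiv i c1.
have [g2 [h2 d2]] := gauss_class_lderiv i c2.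
by have [dd ->] := lderiv_cderivable d1 d2.
Qed.

Lemma cgauss_class_cpartials a b phi (s : seq 'I_n) : cgauss_class a b phi ->
  cgauss_class a b (cpartials s phi).
Proof.
move=> h; elim: s => //= i s ih.
by have [] := cgauss_class_cpartial i ih.
Qed.

(** The bound has to be uniform over all index lists of length at most [N]. There are finitely many;
    peeling off the innermost derivative, which stays in the class, and adding the bounds over its
    direction gives a common one. *)
Lemma cgauss_class_schwartz a b phi : 0 < a -> cgauss_class a b phi -> schwartz phi.
Proof.
move=> a0 hphi; split.
  move=> s x i; have [+ _] := cgauss_class_cpartial i (cgauss_class_cpartials s hphi).
  exact.
move=> N.
(* The length bound [k] is separated from the power [N] of the weight, since only [k] decreases in
   the induction. *)
suff H k psi : cgauss_class a b psi -> exists C : R, forall (s : seq 'I_n) x,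
    (size s <= k)%N -> sqn x ^+ N * cmod (cpartials s psi x) <= C.
  have [C hC] := H N phi hphi; exists C => r [s [x [sN ->]]]; exact: hC.
have s0 x : 0 <= sqn x ^+ N by rewrite exprn_ge0// ltW// sqn_gt0.
have B0 psi' : cgauss_class a b psi' -> exists C : R, 0 <= C /\ forall x,
    sqn x ^+ N * cmod (psi' x) <= C.
  move=> [c1 c2]; have [C1 h1] := gauss_class_bounded a0 c1 N.
  have [C2 h2] := gauss_class_bounded a0 c2 N.
  exists (C1 + C2); split.
    have := lerD (h1 0) (h2 0); apply: le_trans.
    by rewrite addr_ge0// mulr_ge0.
  by move=> x; rewrite (le_trans (ler_wpM2l (s0 _) (cmod_le _)))// mulrDr lerD.
elim: k psi => [|k ih] psi hpsi.
  have [C [C0 hC]] := B0 _ hpsi.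
  by exists C => s x; rewrite leqn0 size_eq0 => /eqP ->; exact: hC.
have [C [C0 hC]] := B0 _ hpsi.
have /choice[D hD] : forall i, exists D : R, forall (s : seq 'I_n) x, (size s <= k)%N ->
    sqn x ^+ N * cmod (cpartials s (cpartial i psi) x) <= D.
  by move=> i; apply: ih; have [] := cgauss_class_cpartial i hpsi.
have D0 i : 0 <= D i.
  by apply: le_trans (hD i [::] 0 isT); rewrite mulr_ge0 ?cmod_ge0.
exists (C + \sum_i D i) => s x.
case/lastP: s => [_|s i].
  by rewrite (le_trans (hC x))// lerDl sumr_ge0.
rewrite size_rcons ltnS => sk; rewrite /cpartials foldr_rcons.
rewrite (le_trans (hD i s x sk))// (bigD1 i)//= addrCA lerDl addr_ge0//.
by apply: sumr_ge0.
Qed.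

Lemma gaussian_class a b : cgauss_class a b (gaussian a b).
Proof.
split.
  by under eq_fun do rewrite Re_gaussian; constructor.
under eq_fun do rewrite Im_gaussian -mulN1r.
by apply: gauss_scale; constructor.
Qed.

Lemma schwartz_gaussian a b : 0 < a -> schwartz (gaussian a b).
Proof. by move=> a0; apply: cgauss_class_schwartz (gaussian_class a b). Qed.

Lemma lderiv_gaussian a b i :
  lderiv (e_ i) (fun x => complex.Re (gaussian a b x)) (fun x =>
    - (2 * x ord0 i) * (a * complex.Re (gaussian a b x) - b * complex.Im (gaussian a b x))) /\
  lderiv (e_ i) (fun x => complex.Im (gaussian a b x)) (fun x =>
    - (2 * x ord0 i) * (a * complex.Im (gaussian a b x) + b * complex.Re (gaussian a b x))).
Proof.
split.
  have := lderiv_expcos a b i; congr (lderiv _ _ _); apply/funext => x.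
    by rewrite Re_gaussian.
  by rewrite Re_gaussian Im_gaussian; ring.
have := lderivZ (-1) (lderiv_expsin a b i).
congr (lderiv _ _ _); apply/funext => x; first by rewrite Im_gaussian mulN1r.
by rewrite Re_gaussian Im_gaussian; ring.
Qed.

Lemma cpartial_gaussian a b i : cpartial i (gaussian a b) =
  (fun x => (- (2 * x ord0 i))%:C%C * (a +i* b)%C * gaussian a b x).
Proof.
have [d1 d2] := lderiv_gaussian a b i.
have [_ ->] := lderiv_cderivable d1 d2; apply/funext => x.
by apply: complex_ext; rewrite /= ?Re_mul ?Im_mul/= ?Re_mul ?Im_mul/=; ring.
Qed.

(** Vanishing partial derivatives give the Lipschitz constant 0. *)
Lemma lderiv0_cst (f : V -> R) : (forall i, lderiv (e_ i) f (fun=> 0)) ->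
  forall x, f x = f 0.
Proof.
move=> h x; apply/eqP; rewrite -subr_eq0 -normr_le0.
have := @lipschitz_coords R n f 0 _ 0 x; rewrite mul0r; apply=> y i t.
have := @derive_bounded_lipschitz R (fun r => f (y + r *: e_ i)) _ 0
  (lderiv_line (h i) y) _ 0 t.
by rewrite scale0r addr0 subr0; apply=> _; rewrite normr0.
Qed.

(* The transform divided by the expected answer is constant, because both solve
   the same first-order equation along each coordinate. *)
Lemma fourier_gaussian a b xi : 0 < a ->
  fourier (gaussian a b) xi = cint (gaussian a b) *
    gaussian (a / (4 * (a ^+ 2 + b ^+ 2))) (- b / (4 * (a ^+ 2 + b ^+ 2))) xi.
Proof.
move=> a0; pose G : V -> R[i] := gaussian a b.
pose r2 := a ^+ 2 + b ^+ 2.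
have r0 : 0 < r2 by rewrite ltr_pwDl ?exprn_gt0// sqr_ge0.
pose a' := a / (4 * r2); pose b' := - b / (4 * r2).
have sG : schwartz G by exact: schwartz_gaussian.
have iG := schwartz_cintegrable sG.
(* With [w = a + i b], [a' + i b'] is [1 / (4 w)] and [z] is [i / (2 w)], the factor for which [z]
   times [cpartial i G] is [- i x_i G]. *)
pose z := (- (2 * b') +i* (2 * a'))%C.
have a'0 : 0 < a' by rewrite divr_gt0// mulr_gt0.
have z0 : z != 0.
  by apply/eqP => -[_ /eqP]; rewrite mulf_eq0 pnatr_eq0/= gt_eqF.
have dG i : cpartial i G = (fun x => z^-1 * ((0 +i* - x ord0 i)%C * G x)).
  rewrite cpartial_gaussian; apply/funext => x.
  rewrite -[gaussian a b x]/(G x); move: (G x) => g; rewrite [RHS]mulrA; congr (_ * g).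
  apply: (mulfI z0); rewrite [RHS]mulrA divff// mul1r.
  apply: complex_ext; rewrite ?Re_mul ?Im_mul/= ?Re_mul ?Im_mul/= /a' /b' /r2; field;
    exact: lt0r_neq0.
have ixG i : cintegrable (fun x => (0 +i* - x ord0 i)%C * G x).
  have := schwartz_cintegrable (schwartz_cpartial i sG).
  move/(cintegrableZ z); congr cintegrable; apply/funext => x.
  by rewrite dG mulrA divff// mul1r.
(* The left side is the derivative of [fourier G] along coordinate [i], so [fourier G] solves the
   equation of a gaussian of parameter [a' + i b']. *)
have FxG i eta : fourier (fun x => (0 +i* - x ord0 i)%C * G x) eta =
    (- (2 * eta ord0 i))%:C%C * (a' +i* b')%C * fourier G eta.
  have := fourier_cpartial i eta sG; rewrite dG fourierZ// => h.
  apply: (mulfI (invr_neq0 z0)); rewrite h mulrA; congr (_ * _).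
  apply: (mulfI z0); rewrite mulrA divff// mul1r.
  by apply: complex_ext; rewrite ?Re_mul ?Im_mul/= ?Re_mul ?Im_mul/=; ring.
(* Dividing by the expected gaussian is multiplying by the growing one of opposite parameter; only
   local derivatives are taken, so its growth is harmless. *)
pose H eta := gaussian (- a') (- b') eta * fourier G eta.
have Hcst eta : H eta = H 0.
  have dH i := (lderiv_gaussian (- a') (- b') i, lderiv_fourier iG (ixG i)).
  apply: complex_ext.
    apply: (lderiv0_cst (f := fun eta => complex.Re (H eta))) => i.
    have [[d1 d2] [d3 d4]] := dH i.
    have := lderivD (lderivM d1 d3) (lderivZ (-1) (lderivM d2 d4)).
    congr (lderiv _ _ _); apply/funext => y; first by rewrite Re_mul mulN1r.
    by rewrite FxG; move: (gaussian _ _ y) (fourier G y) => [p r] [u v] /=; ring.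
  apply: (lderiv0_cst (f := fun eta => complex.Im (H eta))) => i.
  have [[d1 d2] [d3 d4]] := dH i.
  have := lderivD (lderivM d1 d4) (lderivM d2 d3).
  congr (lderiv _ _ _); apply/funext => y.
  by rewrite FxG; move: (gaussian _ _ y) (fourier G y) => [p r] [u v] /=; ring.
have := Hcst xi; rewrite /H gaussian_at0 mul1r.
have -> : fourier G 0 = cint G.
  congr cint; apply/funext => x.
  have -> : dotv x 0 = 0 by rewrite /dotv big1// => i _; rewrite mxE mulr0.
  by rewrite oppr0 cis0 mul1r.
move=> <-; rewrite mulrAC gaussianM !addNr.
by rewrite gaussian00 mul1r.
Qed.

End gaussian.

(** * Inversion at the origin and the distribution f *)

Section inversion.
Context {R : realType} {n : nat}.
Local Notation V := 'rV[R]_n.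
Local Notation mu := (@lebesgue_rV R n).
Implicit Types (f g phi psi : V -> R[i]) (x xi : V) (a b : R).

Definition invn (k : nat) : R := k.+1%:R^-1.

Lemma invn_gt0 k : 0 < invn k.
Proof. by rewrite invr_gt0 ltr0n. Qed.

(** The factor [4^-1] is chosen so that the transform is proportional to the gaussian of parameter
    [(invn k)^-1 ^+ 2], that is, an approximate identity at scale [invn k]. *)
Definition gauss_cutoff (k : nat) : V -> R[i] := gaussian (invn k ^+ 2 * 4^-1) 0.

Lemma gauss_cutoff_gt0 k : 0 < invn k ^+ 2 * 4^-1.
Proof. by rewrite mulr_gt0 ?exprn_gt0 ?invn_gt0 ?invr_gt0. Qed.

(** Classically this is [(2 pi)^n], the constant of Fourier inversion, obtained here as the integral
    of a limiting cutoff profile times that of its rescaled transform. *)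
Definition gauss_const : R[i] := cint (@gaussian R n 4^-1 0) * cint (@gaussian R n 1 0).

Lemma gaussian_cintegrable a b : 0 < a -> cintegrable (@gaussian R n a b).
Proof. by move=> a0; apply: schwartz_cintegrable; exact: schwartz_gaussian. Qed.

Lemma cint_gaussian_scale a b (k : R) : 0 < k -> 0 < a ->
  cint (@gaussian R n (k ^+ 2 * a) (k ^+ 2 * b)) = (k^-1 ^+ n)%:C%C * cint (@gaussian R n a b).
Proof.
move=> k0 a0; have := cint_affine 0 (lt0r_neq0 k0) (gaussian_cintegrable b a0).
rewrite gtr0_norm// => <-; congr cint; apply/funext => x.
by rewrite addr0 gaussian_scale.
Qed.

Lemma fourier_gauss_cutoff k xi : fourier (gauss_cutoff k) xi =
  (((invn k)^-1 ^+ n)%:C%C * cint (@gaussian R n 4^-1 0)) *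
  gaussian ((invn k)^-1 ^+ 2) 0 xi.
Proof.
rewrite fourier_gaussian ?gauss_cutoff_gt0//; congr (_ * gaussian _ _ xi).
- rewrite -cint_gaussian_scale ?invn_gt0// ?invr_gt0//.
  by congr cint; rewrite /gauss_cutoff mulr0.
- have h := lt0r_neq0 (invn_gt0 k); by field.
- by rewrite oppr0 mul0r.
Qed.

Lemma cvg_invn2 (c : R) : (fun k => invn k ^+ 2 * c) @ \oo --> 0.
Proof.
have h := @cvg_harmonic R.
have := cvgM (cvgM h h) (cvg_cst (F := \oo) c); rewrite mul0r mul0r; exact.
Qed.

Lemma gauss_cutoff_cvg x : ccvg (gauss_cutoff ^~ x) 1.
Proof.
have -> : (1 : R[i]) = (expR (- 0))%:C%C * cis (- 0).
  by rewrite oppr0 expR0 cis0 mulr1.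
apply: ccvgM; last by rewrite mul0r; exact: ccvg_cst.
apply: ccvg_real; apply: continuous_cvg; first exact: continuous_expR.
apply: cvgN; under eq_fun do rewrite -mulrA; exact: cvg_invn2.
Qed.

Lemma cmod_gauss_cutoff_le1 k x : cmod (gauss_cutoff k x) <= 1.
Proof.
rewrite cmod_gaussian -[leRHS]expR0 ler_expR oppr_le0 mulr_ge0 ?dotv_ge0//.
exact: ltW (gauss_cutoff_gt0 k).
Qed.

Lemma gauss_cutoff_measurable k : cmeasurable (gauss_cutoff k).
Proof. by apply: cintegrable_meas; apply: gaussian_cintegrable; exact: gauss_cutoff_gt0. Qed.

Lemma cvg_cint_gauss_cutoff f : cintegrable f ->
  ccvg (fun k => cint (fun x => gauss_cutoff k x * f x)) (cint f).
Proof.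
move=> intf; have mf := cintegrable_meas intf.
apply: dominated_cint (integrable_cmod intf) _ _ => //.
- by move=> k; apply: cmeasurableM => //; exact: gauss_cutoff_measurable.
- move=> x; rewrite -[X in ccvg _ X]mul1r.
  by apply: ccvgM; [exact: gauss_cutoff_cvg|exact: ccvg_cst].
- move=> k x; rewrite cmodM -[leRHS]mul1r ler_wpM2r ?cmod_ge0//.
  exact: cmod_gauss_cutoff_le1.
Qed.

(* The gaussian cutoff stands in for integrability of [fourier g], which is
   never proved. *)
Lemma fourier_inversion0 g (M : R) : cintegrable g -> (forall x, cmod (g x) <= M) ->
  (forall x, ccvg (fun k => g (invn k *: x)) (g 0)) ->
  ccvg (fun k => cint (fun x => gauss_cutoff k x * fourier g x)) (gauss_const * g 0).
Proof.
move=> intg gM gc; have mg := cintegrable_meas intg.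
have i1 := gaussian_cintegrable 0 (@ltr01 R).
(* The multiplication formula moves the transform onto the cutoff; the substitution
   [x -> invn k *: x] then makes the gaussian independent of [k] and cancels the power of
   [invn k]. *)
have E k : cint (fun x => gauss_cutoff k x * fourier g x) =
    cint (@gaussian R n 4^-1 0) * cint (fun x => g (invn k *: x) * gaussian 1 0 x).
  have k0 := invn_gt0 k.
  have ki0 : 0 < (invn k)^-1 ^+ 2 by rewrite exprn_gt0// invr_gt0.
  have ig : cintegrable (fun x => g x * gaussian ((invn k)^-1 ^+ 2) 0 x).
    apply: (cintegrableM_bounded (M := M)) => //.
    exact: gaussian_cintegrable.
  rewrite fourier_multiplication//; last first.
    by apply: gaussian_cintegrable; exact: gauss_cutoff_gt0.
  under eq_fun do rewrite fourier_gauss_cutoff mulrCA.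
  rewrite cintZ// -mulrA mulrCA; congr (_ * _).
  have := cint_affine 0 (lt0r_neq0 k0) ig; rewrite gtr0_norm// => <-.
  congr cint; apply/funext => x.
  rewrite addr0 gaussian_scale; congr (_ * gaussian _ _ x).
    by rewrite exprVn divff// expf_neq0// lt0r_neq0.
  by rewrite mulr0.
under eq_fun do rewrite E.
rewrite /gauss_const -mulrA; apply: ccvgM; first exact: ccvg_cst.
rewrite mulrC -cintZ//.
apply: (@dominated_cint _ _ _ _ (fun x => M * cmod (@gaussian R n 1 0 x))).
- move=> k; apply: cmeasurableM; last exact: cintegrable_meas.
  have [m1 m2] := mg.
  have ma := measurable_affine_rV (invn k) (0 : V).
  have h (u : V -> R) : measurable_fun setT u -> measurable_fun setT (fun x => u (invn k *: x)).
    move=> mu_; have := measurableT_comp mu_ ma.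
    by congr (measurable_fun _ _); apply/funext => x /=; rewrite addr0.
  by split; [exact: (h _ m1)|exact: (h _ m2)].
- by apply: cmeasurableM; [exact: cmeasurable_cst|exact: cintegrable_meas].
- by apply: integrable_scale; exact: integrable_cmod.
- by move=> x; apply: ccvgM; [exact: gc|exact: ccvg_cst].
- by move=> k x; rewrite cmodM ler_wpM2r ?cmod_ge0.
Qed.

(* [psi |-> int psi], extended by a gaussian regularization to Fourier
   transforms whose integrability is not known. *)
Definition reg_integral psi : R[i] :=
  (limn (fun k => complex.Re (cint (fun x => gauss_cutoff k x * psi x))) +i*
   limn (fun k => complex.Im (cint (fun x => gauss_cutoff k x * psi x))))%C.

Lemma reg_integral_ccvg psi (l : R[i]) :
  ccvg (fun k => cint (fun x => gauss_cutoff k x * psi x)) l -> reg_integral psi = l.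
Proof.
move=> [h1 h2]; apply: complex_ext => /=.
  exact/cvg_lim.
exact/cvg_lim.
Qed.

Lemma reg_integralE psi : cintegrable psi -> reg_integral psi = cint psi.
Proof. by move=> ipsi; apply: reg_integral_ccvg; exact: cvg_cint_gauss_cutoff. Qed.

(** On Schwartz functions the regularization returns the ordinary integral, so [f] is integration
    against the constant 1. *)
Lemma tempered_reg_integral : tempered reg_integral.
Proof.
split.
- move=> phi psi /schwartz_cintegrable iphi /schwartz_cintegrable ipsi.
  by rewrite !reg_integralE ?cintD//; exact: cintegrableD.
- move=> c phi /schwartz_cintegrable iphi.
  by rewrite !reg_integralE ?cintZ//; exact: cintegrableZ.
- exists n, (2 * \int[mu]_x (sqn x ^- n)) => phi hphi.
  have iphi := schwartz_cintegrable hphi.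
  rewrite reg_integralE// (le_trans (cmod_cint_le iphi))//.
  rewrite -mulrA ler_wpM2l// mulrC -RintegralZl//; last exact: integrable_sqnV.
  apply: le_Rintegral => //.
  + exact: integrable_cmod.
  + exact: integrable_decay.
  + by move=> x _; exact: schwartz_decay.
Qed.

Lemma fourier_invE phi x :
  fourier_inv phi x = (((2 * pi) ^+ n)^-1)%:C%C * fourier phi (- x).
Proof.
rewrite /fourier_inv /fourier; congr (_ * cint _); apply/funext => y.
congr (cis _ * _); rewrite dotvC /dotv -sumrN; apply: eq_bigr => i _.
by rewrite mxE mulrN opprK.
Qed.

Lemma sqnN x : sqn (- x) = sqn x.
Proof.
by rewrite /sqn /dotv; congr (1 + _); apply: eq_bigr => i _; rewrite !mxE mulrNN.
Qed.

Lemma bracket_cmeasurable (s : R) : cmeasurable (@bracket R n s).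
Proof.
apply: cmeasurable_real.
exact: (measurableT_comp (measurable_powR (s / 2)) (@measurable_sqn R n)).
Qed.

Lemma bracket_le (s : R) x : s <= n%:R -> cmod (bracket s x) <= sqn x ^+ n.
Proof.
move=> sn; rewrite cmod_real ger0_norm ?powR_ge0// -powR_mulrn ?(ltW (sqn_gt0 _))//.
by apply: ler_powR; [exact: sqn_ge1|have := ler0n R n; lra].
Qed.

Lemma bracket_ccvg (s : R) x : ccvg (fun k => bracket s (invn k *: x)) (bracket s (0 : V)).
Proof.
have z : dotv (0 : V) 0 = 0 by rewrite /dotv big1// => i _; rewrite mxE mul0r.
have E (y : V) : bracket s y = (expR (s / 2 * ln (1 + dotv y y)))%:C%C.
  by rewrite /bracket /powR gt_eqF// -/(sqn y) sqn_gt0.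
under eq_fun do rewrite E; rewrite E.
apply: ccvg_real; apply: continuous_cvg; first exact: continuous_expR.
apply: cvgM; first exact: cvg_cst.
apply: continuous_cvg; first by apply: continuous_ln; rewrite z addr0.
apply: cvgD; first exact: cvg_cst.
rewrite z (_ : (fun _ => _) = (fun k => invn k ^+ 2 * dotv x x)).
  exact: cvg_invn2.
apply/funext => k.
by rewrite /dotv mulr_sumr; apply: eq_bigr => i _; rewrite !mxE; ring.
Qed.

(** With [g = bracket s * fourier_inv phi], the left side is the regularized integral of
    [fourier g], hence [gauss_const * g 0]; the weight is 1 at the origin, where [fourier_inv phi]
    is a multiple of [cint phi]. *)
Lemma bessel_reg_integral (s : R) phi : s <= n%:R -> schwartz phi ->
  bessel s reg_integral phi =
  gauss_const * (((2 * pi) ^+ n)^-1)%:C%C * cint phi.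
Proof.
move=> sn hphi; have iphi := schwartz_cintegrable hphi.
pose c : R[i] := (((2 * pi) ^+ n)^-1)%:C%C.
pose g x := bracket s x * fourier_inv phi x.
(* Of the [n + n] powers, [n] pay for the growth of [bracket s] and [n] make [g] integrable. *)
have [C hC] := fourier_decay (n + n) hphi.
have gC x : cmod (g x) <= (cmod c * C) * sqn x ^- n.
  rewrite ler_pdivlMr ?exprn_gt0 ?sqn_gt0// /g fourier_invE !cmodM.
  rewrite -/c mulrCA -!mulrA ler_wpM2l ?cmod_ge0//.
  rewrite (le_trans _ (hC (- x)))// sqnN exprD -mulrA ler_pM//.
  - exact: cmod_ge0.
  - by rewrite mulr_ge0 ?cmod_ge0// exprn_ge0// ltW// sqn_gt0.
  - exact: bracket_le.
  - by rewrite mulrC.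
have mg : cmeasurable g.
  apply: cmeasurableM; first exact: bracket_cmeasurable.
  rewrite (funext (fourier_invE phi)).
  apply: cmeasurableM; first exact: cmeasurable_cst.
  have [m1 m2] := cmeasurable_fourier (cintegrable_meas iphi).
  have ma := measurable_affine_rV (-1) (0 : V).
  have h (u : V -> R) : measurable_fun setT u -> measurable_fun setT (fun x => u (- x)).
    move=> mu_; have := measurableT_comp mu_ ma.
    by congr (measurable_fun _ _); apply/funext => x /=; rewrite addr0 scaleN1r.
  by split; [exact: (h _ m1)|exact: (h _ m2)].
have ig : cintegrable g by exact: cintegrable_le (integrable_decay _) gC.
have cC0 : 0 <= cmod c * C.
  rewrite mulr_ge0 ?cmod_ge0// (le_trans _ (hC 0))// mulr_ge0 ?cmod_ge0//.
  by rewrite exprn_ge0// ltW// sqn_gt0.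
have bg x : cmod (g x) <= cmod c * C.
  rewrite (le_trans (gC x))// -[leRHS]mulr1 ler_wpM2l//.
  by rewrite invf_le1 ?exprn_gt0 ?sqn_gt0// exprn_ege1// sqn_ge1.
have cg x : ccvg (fun k => g (invn k *: x)) (g 0).
  apply: ccvgM; first exact: bracket_ccvg.
  under eq_fun do rewrite fourier_invE; rewrite fourier_invE.
  apply: ccvgM; first exact: ccvg_cst.
  apply: fourier_ccvg => // y.
  rewrite (_ : dotv y (- 0) = 0 * - dotv y x); last first.
    by rewrite oppr0 mul0r /dotv big1// => i _; rewrite mxE mulr0.
  rewrite (_ : (fun _ => _) = (fun k => invn k * - dotv y x)); last first.
    apply/funext => k; rewrite /dotv -sumrN mulr_sumr.
    by apply: eq_bigr => i _; rewrite !mxE; ring.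
  by apply: cvgM; [exact: cvg_harmonic|exact: cvg_cst].
rewrite /bessel /dist_fourier_inv /dist_mul /dist_fourier.
rewrite (reg_integral_ccvg (fourier_inversion0 ig bg cg)) -mulrA; congr (_ * _).
have z : dotv (0 : V) 0 = 0 by rewrite /dotv big1// => i _; rewrite mxE mul0r.
have -> : g 0 = fourier_inv phi 0.
  by rewrite /g /bracket z addr0 powR1 mul1r.
rewrite fourier_invE oppr0; congr (_ * cint _); apply/funext => y.
have -> : dotv y 0 = 0 by rewrite /dotv big1// => i _; rewrite mxE mulr0.
by rewrite oppr0 cis0 mul1r.
Qed.

Lemma bessel_density_reg_integral (s : R) : s <= n%:R ->
  bessel_density s reg_integral (fun=> gauss_const * (((2 * pi) ^+ n)^-1)%:C%C).
Proof.
move=> sn; set c := _ * _; split.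
  split; first exact: cmeasurable_cst.
  move=> phi hphi; have iphi := schwartz_cintegrable hphi.
  split; first exact: cintegrableZ.
  by rewrite bessel_reg_integral// /regular_dist cintZ.
split; first exact: cmeasurable_cst.
(* The norm is defined by cases on whether the whole space has positive measure; it is finite in
   both. *)
rewrite unlock; case: ifPn => mu0; last exact: ltry.
rewrite (_ : _ \o _ = cst `|cmod c|%:E); last by apply/funext.
by rewrite ess_sup_inf.ess_sup_cst// ltry.
Qed.

End inversion.

(** * Dyadic shells and gaussian constants *)

Section shells.
Context {R : realType} {n : nat}.
Hypothesis n_gt0 : (0 < n)%N.
Local Notation V := 'rV[R]_n.
Local Notation mu := (@lebesgue_rV R n).

(** Only a cube in the positive orthant, not a full annulus: it has the explicit measure [2^(k n)]
    and still lies at distance of order [2^k] from the origin. *)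
Definition shell (k : nat) : set V := box `](2 ^+ k)%R, (2 ^+ k.+1)%R]%classic.

Lemma measurable_shell k : measurable (shell k).
Proof. exact: measurable_box. Qed.

Lemma lebesgue_shell k : mu (shell k) = ((2 ^+ k) ^+ n)%:E.
Proof.
rewrite lebesgue_rV_box//= lebesgue_measure_itv/= lte_fin.
rewrite ltr_eXn2l ?ltr1n// ltnSn -EFinB -EFin_expe; congr ((_ ^+ n)%:E).
by rewrite exprS; ring.
Qed.

Lemma trivIset_shell (N : nat) : trivIset [set` iota 0 N] shell.
Proof.
move=> i j _ _ [x [xi xj]].
(* One coordinate suffices to separate two shells; in dimension 0 they would all be the same
   point. *)
have := xi (Ordinal n_gt0); have := xj (Ordinal n_gt0).
rewrite /= !in_itv/= => /andP[j1 j2] /andP[i1 i2].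
have h1 := lt_le_trans j1 i2; have h2 := lt_le_trans i1 j2.
rewrite !ltr_eXn2l ?ltr1n// !ltnS in h1 h2.
by apply/eqP; rewrite eqn_leq h1 h2.
Qed.

(** Shell [k] has measure [(2 ^+ k) ^+ n], so it contributes at least [c], and the [N] shells are
    disjoint. *)
Lemma shell_lower_bound (f : V -> R) (c : R) (N : nat) :
  measurable_fun setT f -> (forall x, 0 <= f x) -> 0 <= c ->
  (forall k x, (k < N)%N -> shell k x -> c * (2 ^+ k) ^- n <= f x) ->
  ((N%:R * c)%:E <= \int[mu]_x (f x)%:E)%E.
Proof.
move=> mf f0 c0 fc.
have mE : measurable_fun setT (EFin \o f) by exact/measurable_EFinP.
have mD : measurable (\big[setU/set0]_(k <- iota 0 N) shell k).
  by apply: bigsetU_measurable => k _; exact: measurable_shell.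
apply: (@le_trans _ _ (\int[mu]_(x in \big[setU/set0]_(k <- iota 0 N) shell k) (f x)%:E)%E); last first.
  by apply: ge0_subset_integral => //; move=> x _; rewrite lee_fin.
rewrite ge0_integral_bigsetU//=; last 5 first.
- exact: measurable_shell.
- exact: iota_uniq.
- exact: trivIset_shell.
- exact: measurable_funTS.
- by move=> x _; rewrite lee_fin.
rewrite (_ : N%:R * c = \sum_(k <- iota 0 N) c); last first.
  by rewrite big_const_seq count_predT size_iota iter_addr_0 mulr_natl.
rewrite -sumEFin; rewrite big_seq [leRHS]big_seq; apply: lee_sum => k.
rewrite mem_iota add0n => /andP[_ kN].
apply: (@le_trans _ _ (\int[mu]_(x in shell k) (c * (2 ^+ k) ^- n)%:E)%E).
  rewrite integral_cst//=; last exact: measurable_shell.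
  rewrite lebesgue_shell -EFinM lee_fin -mulrA mulVf ?mulr1//.
apply: ge0_le_integral => //.
- exact: measurable_shell.
- move=> x _; rewrite lee_fin mulr_ge0// invr_ge0 exprn_ge0// exprn_ge0//.
- exact: measurable_funTS.
- by move=> x xk; rewrite lee_fin; exact: fc.
Qed.

(** The bound is deliberately crude and written as a square, so that the power [n / 2] of it is an
    integral power. *)
Lemma sqn_shell k x : shell k x -> sqn (x : V) <= (2 ^+ k * (1 + 4 * n%:R)) ^+ 2.
Proof.
move=> hx; have p1 : 1 <= 2 ^+ k :> R by rewrite exprn_ege1// ler1n.
have n0 : 0 <= n%:R :> R by [].
have : dotv x x <= n%:R * (2 ^+ k.+1) ^+ 2.
  rewrite /dotv mulr_natl -[X in _ *+ X](card_ord n) -sumr_const.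
  apply: ler_sum => i _; have := hx i; rewrite /= in_itv/= => /andP[h1 h2].
  have x0 : 0 <= x ord0 i by rewrite (le_trans _ (ltW h1))// (le_trans _ p1).
  by rewrite -expr2 lerXn2r// nnegrE exprn_ge0.
rewrite /sqn [2 ^+ k.+1]exprS !exprMn; have q1 : 1 <= (2 ^+ k) ^+ 2 :> R by rewrite exprn_ege1.
set q := (2 ^+ k) ^+ 2 in q1 *; set m := n%:R in n0 *.
have qm : 0 <= q * m by rewrite mulr_ge0// (le_trans ler01).
have qmm : 0 <= q * m * m by rewrite mulr_ge0.
have -> : q * (1 + 4 * m) ^+ 2 = q + 8 * (q * m) + 16 * (q * m * m) by ring.
have -> : m * (2 ^+ 2 * q) = 4 * (q * m) by ring.
lra.
Qed.

Lemma powR_neg_antitone (x y r : R) : 0 < x -> x <= y -> 0 <= r ->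
  y `^ (- r) <= x `^ (- r).
Proof.
move=> x0 xy r0; have y0 := lt_le_trans x0 xy.
rewrite !powRN lef_pV2 ?posrE ?powR_gt0//.
by apply: ge0_ler_powR => //; rewrite nnegrE ltW.
Qed.

(** Here [s <= n] acts: the weight decays no faster than [|x|^-n], which exactly balances the
    measure of the shell. *)
Lemma bracket_shell (s : R) k (x : V) : s <= n%:R -> shell k x ->
  (1 + 4 * n%:R) ^- n * (2 ^+ k) ^- n <= sqn x `^ (- s / 2).
Proof.
move=> sn hx; have n0 : 0 <= n%:R :> R by [].
have p0 : 0 < 2 ^+ k * (1 + 4 * n%:R) :> R.
  by rewrite mulr_gt0 ?exprn_gt0// ltr_pwDl// mulr_ge0.
rewrite -invfM -exprMn [X in X ^- n]mulrC.
apply: (@le_trans _ _ (sqn x `^ (- (n%:R / 2)))); last first.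
  by apply: ler_powR; [exact: sqn_ge1|lra].
apply: le_trans (powR_neg_antitone (sqn_gt0 x) (sqn_shell hx) _); last first.
  by rewrite divr_ge0.
rewrite powRN -(powR_mulrn 2 (ltW p0)) -powRrM -(powR_mulrn n (ltW p0)).
by rewrite [2 * _]mulrC divfK.
Qed.

(** Strict positivity comes from a lower bound on shell 0 alone, where [|x|^2] is at most
    [(1 + 4 n)^2]. *)
Lemma cint_gaussian0_gt0 (a : R) : 0 < a ->
  exists2 r : R, 0 < r & cint (@gaussian R n a 0) = r%:C%C.
Proof.
move=> a0; exists (\int[mu]_x expR (- (a * dotv x x))); last first.
  rewrite -cint_real; congr cint; apply/funext => x.
  by rewrite /gaussian mul0r oppr0 cis0 mulr1.
have [ig _] := gaussian_cintegrable (n := n) 0 a0.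
have ie : mu.-integrable setT (EFin \o (fun x => expR (- (a * dotv x x)))).
  move: ig; congr (_.-integrable _ _); apply/funext => x.
  by rewrite Re_gaussian mul0r cos0 mulr1.
pose c := expR (- (a * (1 + 4 * n%:R) ^+ 2)).
have c0 : 0 < c by exact: expR_gt0.
have me : measurable_fun setT (fun x : V => expR (- (a * dotv x x))).
  by apply/measurable_EFinP; exact: (measurable_int mu).
apply: (lt_le_trans c0); rewrite -lee_fin /Rintegral fineK; last exact: integrable_fin_num.
have := @shell_lower_bound _ c 1 me (fun x => expR_ge0 _) (ltW c0).
rewrite mul1r; apply=> k x; rewrite ltnS leqn0 => /eqP -> hx.
rewrite expr0 expr1n invr1 mulr1 ler_expR lerN2 ler_wpM2l ?(ltW a0)//.
have := sqn_shell hx; rewrite expr0 mul1r; apply: le_trans.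
by rewrite /sqn lerDr.
Qed.

End shells.

(** * Modulus of complex gaussian integrals *)

Section gaussian_constants.
Context {R : realType} {n : nat}.
Hypothesis n_gt0 : (0 < n)%N.
Local Notation V := 'rV[R]_n.
Local Notation C a b := (cint (@gaussian R n a b)).

Lemma gauss_const_neq0 : @gauss_const R n != 0.
Proof.
rewrite /gauss_const; have [r r0 ->] := cint_gaussian0_gt0 n_gt0 (@ltr01 R).
have h : 0 < 4^-1 :> R by rewrite invr_gt0.
have [q q0 ->] := cint_gaussian0_gt0 n_gt0 h.
by rewrite -rmorphM/= eq_complex/= eqxx andbT gt_eqF// mulr_gt0.
Qed.

(** Inversion at the origin applied to the gaussian itself. Its transform is an integrable gaussian,
    so the regularized limit is also the ordinary integral, and the two values of the limit
    agree. *)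
Lemma gaussian_duality (a b : R) : 0 < a ->
  C a b * C (a / (4 * (a ^+ 2 + b ^+ 2))) (- b / (4 * (a ^+ 2 + b ^+ 2))) =
  @gauss_const R n.
Proof.
move=> a0; set a' := a / _; set b' := - b / _.
have r0 : 0 < a ^+ 2 + b ^+ 2 by rewrite ltr_pwDl ?exprn_gt0// sqr_ge0.
have a'0 : 0 < a' by rewrite divr_gt0// mulr_gt0.
pose g : V -> R[i] := gaussian a b.
have ig : cintegrable g by exact: gaussian_cintegrable.
have bg x : cmod (g x) <= 1.
  rewrite cmod_gaussian -[leRHS]expR0 ler_expR oppr_le0.
  by rewrite mulr_ge0 ?dotv_ge0// ltW.
have cg x : ccvg (fun k => g (invn k *: x)) (g 0).
  rewrite /g gaussian_at0; under eq_fun do rewrite gaussian_scale.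
  have -> : (1 : R[i]) = (expR (- 0))%:C%C * cis (- 0).
    by rewrite oppr0 expR0 cis0 mulr1.
  apply: ccvgM.
    apply: ccvg_real; apply: continuous_cvg; first exact: continuous_expR.
    by apply: cvgN; under eq_fun do rewrite -mulrA; exact: cvg_invn2.
  by apply: ccvg_cis; apply: cvgN; under eq_fun do rewrite -mulrA; exact: cvg_invn2.
have Fg : fourier g = (fun x => C a b * gaussian a' b' x).
  by apply/funext => x; exact: fourier_gaussian.
have iFg : cintegrable (fourier g).
  by rewrite Fg; apply: cintegrableZ; exact: gaussian_cintegrable.
rewrite -[RHS]mulr1 -[X in _ = _ * X](@gaussian_at0 R n a b).
rewrite -(ccvg_unique (cvg_cint_gauss_cutoff iFg) (fourier_inversion0 ig bg cg)).
by rewrite Fg cintZ//; exact: gaussian_cintegrable.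
Qed.

Lemma cmod_cint_gaussian_conj (a b : R) : 0 < a -> cmod (C a (- b)) = cmod (C a b).
Proof.
move=> a0.
have [_ i2] := gaussian_cintegrable (n := n) b a0.
have re : complex.Re (C a (- b)) = complex.Re (C a b).
  by apply: eq_Rintegral => x _; rewrite !Re_gaussian mulNr cosN.
have im : complex.Im (C a (- b)) = -1 * complex.Im (C a b).
  rewrite [in RHS]/cint [complex.Im (_ +i* _)%C]/= -RintegralZl//.
  apply: eq_Rintegral => x _.
  rewrite -[LHS]/(complex.Im (gaussian a (- b) x)).
  by rewrite (Im_gaussian a (- b) x) (Im_gaussian a b x) [- b * _]mulNr sinN; ring.
by rewrite !cmodE re im mulN1r sqrrN.
Qed.

(** Put [w = a + i b] and [w' = a' + i b' = conj w / k^2]. In the multiplication formula for the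
    parameters [w] and [conj w'] the phases cancel on both sides, leaving the real gaussians of
    parameters [2 a'] and [2 a], which are related by scaling. Hence [|C(w)| = |C(w')| k^-n], and
    duality gives the product [C(w) C(w')]. *)
Lemma cmod_cint_gaussian_sqr (a b k : R) : 0 < a -> 0 < k ->
  k ^+ 2 = 4 * (a ^+ 2 + b ^+ 2) ->
  cmod (C a b) ^+ 2 = cmod (@gauss_const R n) * k^-1 ^+ n.
Proof.
move=> a0 k0 kE.
have k2 : 0 < k ^+ 2 by rewrite exprn_gt0.
pose a' := a / k ^+ 2; pose b' := - b / k ^+ 2.
have a'0 : 0 < a' by rewrite divr_gt0.
have kE' : 4 * (a' ^+ 2 + (- b') ^+ 2) = (k ^+ 2)^-1.
  have h := lt0r_neq0 k0; rewrite /a' /b'.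
  transitivity (4 * (a ^+ 2 + b ^+ 2) / (k ^+ 2) ^+ 2); first by field.
  by rewrite -kE; field.
have dual := gaussian_duality b a0; rewrite -kE -/a' -/b' in dual.
have mul := fourier_multiplication (gaussian_cintegrable (n := n) b a0)
  (gaussian_cintegrable (n := n) (- b') a'0).
have E1 : (fun x : V => gaussian a' (- b') x * fourier (gaussian a b) x) =
    (fun x => C a b * gaussian (2 * a') 0 x).
  apply/funext => x; rewrite (fourier_gaussian b x a0).
  rewrite -kE -/a' -/b' [LHS]mulrCA gaussianM.
  by congr (_ * gaussian _ _ x); ring.
have E2 : (fun x : V => gaussian a b x * fourier (gaussian a' (- b')) x) =
    (fun x => C a' (- b') * gaussian (2 * a) 0 x).
  apply/funext => x; rewrite (fourier_gaussian (- b') x a'0).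
  rewrite kE' [LHS]mulrCA gaussianM.
  have h := lt0r_neq0 k0.
  by congr (_ * gaussian _ _ x); rewrite /a' /b'; field.
have h2a' : 0 < 2 * a' by rewrite mulr_gt0.
have h2a : 0 < 2 * a by rewrite mulr_gt0.
rewrite E1 E2 !cintZ in mul; try exact: gaussian_cintegrable.
have sc := cint_gaussian_scale (n := n) 0 k0 h2a'.
rewrite mulr0 (_ : k ^+ 2 * (2 * a') = 2 * a) in sc; last first.
  by rewrite /a'; have h := lt0r_neq0 k0; field.
have [r r0 rE] := cint_gaussian0_gt0 n_gt0 h2a'.
(* The real gaussian integral common to both sides is positive and can be cancelled. *)
have rn0 : (r%:C)%C != 0 :> R[i] by rewrite eq_complex/= eqxx andbT gt_eqF.
rewrite sc rE mulrA in mul; have {}mul := mulIf rn0 mul.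
have := congr1 (@cmod R) mul; rewrite [RHS]cmodM (cmod_cint_gaussian_conj b' a'0) cmod_real.
rewrite ger0_norm ?exprn_ge0 ?invr_ge0 ?(ltW k0)// => e.
by rewrite expr2 {2}e mulrA -cmodM dual.
Qed.

End gaussian_constants.

(** * The kernel is not integrable *)

Section kernel.
Context {R : realType} {n : nat}.
Hypothesis n_gt0 : (0 < n)%N.
Local Notation V := 'rV[R]_n.
Local Notation mu := (@lebesgue_rV R n).
Variables (s t : R).
Hypotheses (t_gt0 : 0 < t) (s_le_n : s <= n%:R).

Definition damped_symbol (eps : R) (x : V) : R :=
  sqn x `^ (- s / 2) * expR (- (eps * dotv x x)).

Lemma damped_symbol_ge0 eps x : 0 <= damped_symbol eps x.
Proof. by rewrite mulr_ge0 ?powR_ge0 ?expR_ge0. Qed.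

Lemma damped_symbol_measurable eps : measurable_fun setT (damped_symbol eps).
Proof.
apply: measurable_funM.
  exact: (measurableT_comp (measurable_powR _) (@measurable_sqn R n)).
apply: (measurableT_comp (f := expR)); first exact: measurable_expR.
apply: measurable_funN; apply: measurable_funM; first exact: measurable_cst.
exact: measurable_dotv.
Qed.

Lemma damped_symbol_integrable eps : 0 < eps ->
  mu.-integrable setT (EFin \o damped_symbol eps).
Proof.
(* The weight may grow when [s < 0]: [M] powers of the gaussian decay compensate it and [n] more
   give integrability. *)
move=> e0; pose M := Num.bound `|s|.
have sM : - s / 2 <= M%:R.
  have h := archi_boundP (normr_ge0 s); have := ler_norm (- s); rewrite normrN.
  by rewrite -/M in h; have := normr_ge0 s; lra.
have hG := schwartz_gaussian (n := n) 0 e0.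
apply: le_integrable (integrable_decay (schwartz_norm (M + n) (gaussian eps 0))) => //.
  by apply/measurable_EFinP; exact: damped_symbol_measurable.
move=> x _ /=; rewrite lee_fin ger0_norm ?damped_symbol_ge0//.
apply: le_trans (ler_norm _); rewrite ler_pdivlMr ?exprn_gt0 ?sqn_gt0//.
have := @schwartz_norm_ub R n (M + n) (gaussian eps 0) [::] x hG (leq0n _).
apply: le_trans; rewrite /= cmod_gaussian /damped_symbol exprD mulrAC.
rewrite ler_wpM2r ?expR_ge0// ler_wpM2r ?exprn_ge0 ?(ltW (sqn_gt0 _))//.
rewrite -powR_mulrn ?(ltW (sqn_gt0 _))//.
by apply: ler_powR => //; exact: sqn_ge1.
Qed.

(* The Fourier transform of the test function is a chirp that cancels the
   phase of the symbol. *)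
Lemma damped_symbol_bound (K : V -> R[i]) : schrodinger_kernel s t K ->
  cintegrable K ->
  exists B : R, forall eps, 0 < eps -> \int[mu]_x damped_symbol eps x <= B.
Proof.
move=> [mK hK] iK.
pose c : R[i] := (((2 * pi) ^+ n)^-1)%:C%C.
pose A := \int[mu]_x cmod (K x).
have c0 : 0 < cmod c.
  by rewrite cmod_real normr_gt0 gt_eqF// invr_gt0 exprn_gt0// mulr_gt0// pi_gt0.
have k0 : 0 < cmod (@gauss_const R n).
  rewrite lt_neqAle cmod_ge0 andbT eq_sym; apply/eqP => /cmod_eq0/eqP.
  exact/negP/gauss_const_neq0.
(* A lower bound for [|cint phi|] that does not depend on [eps]. *)
pose D := Num.sqrt (cmod (@gauss_const R n) * (2 * t) ^+ n).
have D0 : 0 < D by rewrite sqrtr_gt0 mulr_gt0// exprn_gt0// mulr_gt0.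
exists (2 * A / (cmod c * D)) => eps e0.
pose rho := eps ^+ 2 + t ^+ 2.
have rho0 : 0 < rho by rewrite addr_gt0// exprn_gt0.
pose a := eps / (4 * rho); pose b := t / (4 * rho).
have a0 : 0 < a by rewrite divr_gt0// mulr_gt0.
have rn0 := lt0r_neq0 rho0.
(* For [w = a + i b = 1 / (4 (eps - i t))] this is [4 |w|^2]; it turns the parameter of the
   transform into [eps - i t]. *)
have ab : 4 * (a ^+ 2 + b ^+ 2) = (4 * rho)^-1.
  transitivity (4 * (eps ^+ 2 + t ^+ 2) / (16 * rho ^+ 2)).
    by rewrite /a /b; field.
  by rewrite -/rho; field.
pose phi : V -> R[i] := gaussian a b.
have sphi : schwartz phi by exact: schwartz_gaussian.
have [iKphi Kphi] := hK phi sphi.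
have E : regular_dist K phi = (c * cint phi) * (\int[mu]_x damped_symbol eps x)%:C%C.
  rewrite -Kphi /dist_fourier_inv /regular_dist -cint_real -cintZ; last first.
    have id := damped_symbol_integrable e0.
    apply: cintegrable_le id _.
      apply: cmeasurable_real; exact: damped_symbol_measurable.
    by move=> x; rewrite cmod_real ger0_norm ?damped_symbol_ge0.
  congr cint; apply/funext => x.
  rewrite fourier_invE -/c /phi fourier_gaussian// ab.
  have -> : a / (4 * rho)^-1 = eps by rewrite /a; field.
  have -> : - b / (4 * rho)^-1 = - t by rewrite /b; field.
  rewrite -[- x]scaleN1r gaussian_scale expr2 mulrNN !mul1r.
  rewrite /schrodinger_symbol /bracket /damped_symbol -/(sqn x) rmorphM/=.
  have -> : gaussian eps (- t) x = (expR (- (eps * dotv x x)))%:C%C * cis (t * dotv x x).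
    by rewrite /gaussian mulNr opprK.
  have cc : cis (- (t * dotv x x)) * cis (t * dotv x x) = 1 :> R[i].
    by rewrite -cisD addNr cis0.
  rewrite -[RHS]mulr1 -cc; ring.
have iphi : cmod (regular_dist K phi) <= 2 * A.
  rewrite (le_trans (cmod_cint_le iKphi))// ler_wpM2l//.
  apply: le_Rintegral => //; [exact: integrable_cmod|exact: integrable_cmod|].
  move=> x _; rewrite cmodM -[leRHS]mulr1 ler_wpM2l ?cmod_ge0//.
  rewrite cmod_gaussian -[leRHS]expR0 ler_expR oppr_le0.
  by rewrite mulr_ge0 ?dotv_ge0// ltW.
have I0 : 0 <= \int[mu]_x damped_symbol eps x.
  by apply: Rintegral_ge0 => x _; exact: damped_symbol_ge0.
(* With [k = 1 / (2 sqrt rho)] the squared modulus is [|gauss_const| (2 sqrt rho)^n], and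
   [sqrt rho >= t]. *)
have DC : D <= cmod (cint phi).
  rewrite -(ger0_norm (cmod_ge0 (cint phi))) -sqrtr_sqr ler_wsqrtr//.
  pose k := (2 * Num.sqrt rho)^-1.
  have sr0 : 0 < Num.sqrt rho by rewrite sqrtr_gt0.
  have kk : 0 < k by rewrite invr_gt0 mulr_gt0.
  rewrite (cmod_cint_gaussian_sqr n_gt0 (k := k))//; last first.
    rewrite ab /k exprVn exprMn sqr_sqrtr ?(ltW rho0)//.
    by congr (_ * _)^-1; ring.
  rewrite ler_wpM2l ?(ltW k0)// /k invrK lerXn2r ?nnegrE ?mulr_ge0 ?(ltW t_gt0) ?sqrtr_ge0//.
  rewrite ler_wpM2l// -[t]ger0_norm ?(ltW t_gt0)// -sqrtr_sqr ler_wsqrtr//.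
  by rewrite /rho lerDr sqr_ge0.
rewrite ler_pdivlMr ?mulr_gt0// mulrC (le_trans _ iphi)// E !cmodM [X in _ <= _ * X]cmod_real.
by rewrite ger0_norm// ler_wpM2r// ler_wpM2l ?(ltW c0).
Qed.

(** No limit in [eps] is taken: once the bound [B] is known, enough shells are fixed to exceed it,
    and then [eps] is chosen so small that the damping is negligible on all of them. *)
Lemma schrodinger_kernel_not_integrable (K : V -> R[i]) :
  schrodinger_kernel s t K -> ~ cintegrable K.
Proof.
move=> hK iK; have [B hB] := damped_symbol_bound hK iK.
(* The contribution of one shell: [exp(-1)] from the damping, the other factor from
   [bracket_shell]. *)
pose d : R := expR (-1) * (1 + 4 * n%:R) ^- n.
have n0 : 0 <= n%:R :> R by [].
have p0 : 0 < 1 + 4 * n%:R :> R by rewrite ltr_pwDl// mulr_ge0.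
have d0 : 0 < d by rewrite mulr_gt0 ?expR_gt0// invr_gt0 exprn_gt0.
pose N := Num.bound (`|B| / d).
(* By [sqn_shell], [|x| <= L] on the first [N] shells, so [eps = L^-2] keeps [eps |x|^2 <= 1]
   there. *)
pose L := 2 ^+ N * (1 + 4 * n%:R) : R.
have L0 : 0 < L by rewrite mulr_gt0// exprn_gt0.
have e0 : 0 < L ^- 2 by rewrite invr_gt0 exprn_gt0.
have id := damped_symbol_integrable e0.
have := @shell_lower_bound R n n_gt0 _ d N (damped_symbol_measurable _) (damped_symbol_ge0 _) (ltW d0) _.
suff low k x : (k < N)%N -> shell k x -> d * (2 ^+ k) ^- n <= damped_symbol (L ^- 2) x.
  move=> /(_ _ low); have := hB _ e0; rewrite -lee_fin /Rintegral fineK; last first.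
    exact: integrable_fin_num.
  move=> h1 /le_trans/(_ h1); rewrite lee_fin.
  have := archi_boundP (divr_ge0 (normr_ge0 B) (ltW d0)).
  rewrite -/N ltr_pdivrMr// => h2; have := ler_norm B; lra.
move=> kN hx; rewrite /d /damped_symbol -mulrA mulrC ler_pM ?expR_ge0//.
- exact: bracket_shell.
rewrite ler_expR lerN2 mulrC ler_pdivrMr ?exprn_gt0// mul1r.
apply: (@le_trans _ _ (sqn x)); first by rewrite /sqn lerDr.
rewrite (le_trans (sqn_shell hx))// lerXn2r ?nnegrE ?(ltW L0)//.
by rewrite /L ler_wpM2r ?(ltW p0)// ler_weXn2l ?ler1n// ltnW.
Qed.

End kernel.

Theorem theorem1p5 (R : realType) (n : nat) (hn : (1 <= n)%N)
    (t0 : R) (ht0 : 0 < t0) (ht1 : t0 < 1) (s : R) (hs : s <= n%:R)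
    (K : 'rV[R]_n -> R[i]) (hK : schrodinger_kernel s t0 K) :
  exists f : ('rV[R]_n -> R[i]) -> R[i], Linfty_s s f /\
  exists fs : 'rV[R]_n -> R[i], bessel_density s f fs /\
    (\int[lebesgue_rV R n]_y (cmod (K (- y) * fs y))%:E = +oo)%E.
Proof.
have hd := bessel_density_reg_integral hs.
exists (@reg_integral R n); split.
  by split; [exact: tempered_reg_integral|eexists; exact: hd].
eexists; split; first exact: hd.
set c := _ * _.
have c0 : 0 < cmod c.
  rewrite cmodM mulr_gt0//.
    rewrite lt_neqAle cmod_ge0 andbT eq_sym; apply/eqP => /cmod_eq0/eqP.
    exact/negP/gauss_const_neq0.
  by rewrite cmod_real normr_gt0 gt_eqF// invr_gt0 exprn_gt0// mulr_gt0// pi_gt0.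
have [mK _] := hK.
have mcK : measurable_fun setT (fun y => (cmod (K y))%:E).
  by apply/measurable_EFinP; exact: measurable_cmod.
have K0 y : (0 <= (cmod (K y))%:E)%E by rewrite lee_fin cmod_ge0.
have N1 : (-1 : R) != 0 by rewrite oppr_eq0 oner_eq0.
(* The density is the constant [c], so it factors out, and the reflection [y -> - y] preserves the
   integral. *)
transitivity ((cmod c)%:E * \int[lebesgue_rV R n]_y (cmod (K y))%:E)%E.
  rewrite -ge0_integralZl//; last by rewrite lee_fin ltW.
  have m' : measurable_fun setT (fun y => ((cmod c)%:E * (cmod (K y))%:E)%E).
    by apply: emeasurable_funM.
  have := ge0_integral_rV_affine 0 N1 m'.
  rewrite normrN normr1 invr1 expr1n mul1e => <-; last first.
    by move=> y; rewrite mule_ge0// lee_fin ltW.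
  apply: eq_integral => y _.
  by rewrite addr0 scaleN1r cmodM EFinM muleC.
case: (ltP (\int[lebesgue_rV R n]_y (cmod (K y))%:E)%E +oo%E) => [Koo|].
  by case: (schrodinger_kernel_not_integrable hn ht0 hs hK); exact: cintegrableP.
by rewrite leye_eq => /eqP ->; rewrite gt0_muley// lte_fin.
Qed.
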